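(* Let $S$ be an inverse semigroup and $X$ a topological space. There is an equivalence of categories $\tau\colon\mathsf{Prin}(S,X)\rightleftarrows\mathsf{Univ}(S,X)\colon\rho$ between the category $\mathsf{Prin}(S,X)$ of principal bundles over $S$ in $\mathsf{Sh}(X)$ and the category $\mathsf{Univ}(S,X)$ of universal $S$-sets in the topos $\mathsf{Sh}(X)$.
   Context: $S$ is an inverse semigroup, $E(S)$ its semilattice of idempotents, $\mathbf{d}(s)=s^{-1}s$, $\mathbf{r}(s)=ss^{-1}$, $s\le t$ means $s=te$ for some $e\in E(S)$; for $Y\subseteq S$, $Y^{\uparrow}=\{s\in S: s\ge y\text{ for some }y\in Y\}$. Loganathan's category $L(S)$: objects are the elements of $E(S)$; arrows are pairs $(f,s)$ with $f\in E(S)$, $s\in S$, $\mathbf{r}(s)\le f$, regarded as an arrow from $\mathbf{d}(s)$ to $f$; composition is $(f,s)(\mathbf{d}(s),t)=(f,st)$. Sheaves: $\mathsf{Sh}(X)$ is identified with the category of étale spaces $p\colon E\to X$ ($p$ a local homeomorphism) and continuous maps over $X$; $E_x=p^{-1}(x)$ is the stalk at $x$. Principal bundles: for a small category $\mathcal{C}$ and a functor $E\colon\mathcal{C}\to\mathsf{Sh}(X)$, for an arrow $\alpha\colon c\to d$ and $y\in E(c)$ put $\alpha\cdot y=E(\alpha)(y)$. $E$ is a principal $\mathcal{C}$-bundle if for each $x\in X$: (PB1) $E(c)_x\ne\varnothing$ for some object $c$; (PB2) for any $y\in E(c)_x$, $z\in E(d)_x$ there are arrows $\alpha\colon b\to c$,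 $\beta\colon b\to d$ and $w\in E(b)_x$ with $\alpha\cdot w=y$, $\beta\cdot w=z$; (PB3) for any parallel arrows $\alpha,\beta\colon c\rightrightarrows d$ and $y\in E(c)_x$ with $\alpha\cdot y=\beta\cdot y$ there are an arrow $\gamma\colon b\to c$ and $z\in E(b)_x$ with $\alpha\gamma=\beta\gamma$ and $\gamma\cdot z=y$. Morphisms are natural transformations. $\mathsf{Prin}(S,X)$ is the category of principal $L(S)$-bundles over $X$. $S$-sets: an $S$-set $(Y,\mu)$ is a set $Y$ with a semigroup homomorphism $\mu\colon S\to\mathcal{I}(Y)$ into the symmetric inverse semigroup of partial bijections of $Y$, with $s\cdot y=\mu(s)(y)$ where defined; $S$-sets are assumed effective: for every $y\in Y$ there is $s\in S$ with $s\cdot y$ defined. Two $S$-sets are equivalent if they are isomorphic (a bijection $f$ such that $s\cdot y$ is defined iff $s\cdot f(y)$ is, and then $f(s\cdot y)=s\cdot f(y)$). An inverse subsemigroup $H$ of $S$ is closed if $H^{\uparrow}=H$. Cosets with respect to $H$ are the sets $(xH)^{\uparrow}$ with $\mathbf{d}(x)\in H$; the set $X_H$ of cosets is an $S$-set where $s\cdot(xH)^{\uparrow}$ is defined iff $(sxH)^{\uparrow}$ is a coset, and then $s\cdot(xH)^{\uparrow}=(sxH)^{\uparrow}$. A filter in $E(S)$ is a nonempty upward closed subset closed under products. An $S$-set is universal if it is equivalent to $X_H$ with $H=F^{\uparrow}$ for some filter $F$ in $E(S)$. Universal $S$-sets in $\mathsf{Sh}(X)$: an étale space $\pi\colon E\to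 X$ with an $S$-set structure $(E,\mu)$, $(s,e)\mapsto s\cdot e$ where defined, such that: (U1) for any $x\in X$ there is at least one $e\in E_x$ such that $s\cdot e$ is defined for some $s\in S$; (U2) for any $s\in S$ the set $\{e\in E: s\cdot e\text{ is defined}\}$ is open; (U3) if $s\cdot e$ is defined then $\pi(s\cdot e)=\pi(e)$; (U4) for any $x\in X$, the $S$-set $E_x$ with the restricted action is universal; (U5) the partially defined map $S\times E\to E$, $(s,e)\mapsto s\cdot e$, is continuous, $S$ being discrete. A morphism from $(E,\mu)$ to $(E',\nu)$ is a continuous map $f\colon E\to E'$ over $X$ such that whenever $s\cdot e$ is defined, the action of $s$ on $f(e)$ is defined and equals $f(s\cdot e)$. These form $\mathsf{Univ}(S,X)$. *)

(* Defs.v *)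
From HB Require Import structures.
From mathcomp Require Import all_boot.
From mathcomp Require Import boolp classical_sets topology.

Set Implicit Arguments.
Unset Strict Implicit.
Unset Printing Implicit Defensive.

Local Open Scope classical_set_scope.
Local Open Scope group_scope.

HB.mixin Record Semigroup_isInverse S of Semigroup S := {
  sinv : S -> S;
  mulgVKs : forall s : S, s * sinv s * s = s;
  mulVgKs : forall s : S, sinv s * s * sinv s = sinv s;
  sinv_unique : forall s t : S, s * t * s = s -> t * s * t = t -> t = sinv s
}.

#[short(type="inverseSemigroupType")]
HB.structure Definition InverseSemigroup :=
  {S of Semigroup_isInverse S & Semigroup S}.

Section InverseSemigroupTheory.
Variable S : inverseSemigroupType.
Implicit Types (s t e f x y : S) (Y H F : set S).

Definition Idem : set S := [set e | e * e = e].

Definition dom s := sinv s * s.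
Definition ran s := s * sinv s.

Definition nle s t := exists2 e, Idem e & s = t * e.

Definition upset Y : set S := [set s | exists2 y, Y y & nle y s].

Lemma sinvK s : sinv (sinv s) = s.
Proof. by apply/esym/sinv_unique; rewrite ?mulgVKs ?mulVgKs. Qed.

Lemma idem_sinv e : Idem e -> sinv e = e.
Proof. by rewrite /Idem /= => ee; apply/esym/sinv_unique; rewrite !ee. Qed.

Lemma idem_mul e f : Idem e -> Idem f -> Idem (e * f).
Proof.
rewrite /Idem /= => ee ff.
have ke u : u * e * e = u * e by rewrite -mulgA ee.
have kf u : u * f * f = u * f by rewrite -mulgA ff.
set x := sinv (e * f).
have xK : x * e * f * x = x by rewrite -[x * e * f]mulgA mulVgKs.
have xE : f * x * e = x.
  apply: sinv_unique; rewrite !mulgA ?ke ?kf.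
  - by rewrite -[RHS]mulgVKs !mulgA.
  - transitivity (f * (x * e * f * x) * e); first by rewrite !mulgA.
    by rewrite xK.
have xx : Idem x.
  rewrite /Idem /=; transitivity (f * (x * e * f * x) * e).
    by rewrite -[in LHS]xE !mulgA.
  by rewrite xK xE.
by rewrite -(sinvK (e * f)) -/x (idem_sinv xx).
Qed.

Lemma idemC e f : Idem e -> Idem f -> e * f = f * e.
Proof.
move=> ee ff; have ef := idem_mul ee ff; have fe := idem_mul ff ee.
rewrite /Idem /= in ee ff ef fe.
have ke u : u * e * e = u * e by rewrite -mulgA ee.
have kf u : u * f * f = u * f by rewrite -mulgA ff.
rewrite -[LHS](idem_sinv ef); apply/esym/sinv_unique; rewrite !mulgA ?kf ?ke.
- by rewrite -[RHS]ef !mulgA.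
- by rewrite -[RHS]fe !mulgA.
Qed.

Lemma idem_dom s : Idem (dom s).
Proof. by rewrite /Idem /dom /= mulgA mulVgKs. Qed.

Lemma idem_ran s : Idem (ran s).
Proof. by rewrite /Idem /ran /= mulgA mulgVKs. Qed.

Lemma sinvM s t : sinv (s * t) = sinv t * sinv s.
Proof.
have C : dom s * ran t = ran t * dom s := idemC (idem_dom s) (idem_ran t).
apply/esym/sinv_unique.
- transitivity (s * (ran t * dom s) * t); first by rewrite /ran /dom !mulgA.
  by rewrite -C /ran /dom !mulgA mulgVKs -!mulgA (mulgA t) mulgVKs.
- transitivity (sinv t * (dom s * ran t) * sinv s).
    by rewrite /ran /dom !mulgA.
  by rewrite C /ran /dom !mulgA mulVgKs -!mulgA (mulgA (sinv s)) mulVgKs.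
Qed.

Lemma dom_idem e : Idem e -> dom e = e.
Proof. by move=> ee; rewrite /dom idem_sinv. Qed.

Lemma ran_idem e : Idem e -> ran e = e.
Proof. by move=> ee; rewrite /ran idem_sinv. Qed.

Lemma mulg_dom s : s * dom s = s.
Proof. by rewrite /dom mulgA mulgVKs. Qed.

Lemma ran_mulg s : ran s * s = s.
Proof. by rewrite /ran mulgVKs. Qed.

Lemma idem_conj s e : Idem e -> Idem (sinv s * e * s).
Proof.
move=> ee; rewrite /Idem /=.
transitivity (sinv s * (e * ran s) * e * s); first by rewrite /ran !mulgA.
rewrite (idemC ee (idem_ran s)) /ran !mulgA mulVgKs.
by rewrite -(mulgA _ e e) ee.
Qed.

Lemma idem_mulC s e : Idem e -> e * s = s * (sinv s * e * s).
Proof.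
move=> ee; rewrite -{1}(ran_mulg s) mulgA (idemC ee (idem_ran s)).
by rewrite /ran !mulgA.
Qed.

Lemma nle_refl s : nle s s.
Proof. by exists (dom s); [exact: idem_dom | rewrite mulg_dom]. Qed.

Lemma nle_trans t s u : nle s t -> nle t u -> nle s u.
Proof.
move=> [e ee ->] [f ff ->]; exists (f * e); first exact: idem_mul.
by rewrite mulgA.
Qed.

Lemma nle_mul s t s' t' : nle s s' -> nle t t' -> nle (s * t) (s' * t').
Proof.
move=> [e ee ->] [f ff ->]; exists (sinv t' * e * t' * f).
  by apply: idem_mul => //; exact: idem_conj.
by rewrite -mulgA (mulgA e) (idem_mulC _ ee) !mulgA.
Qed.

Lemma nle_sinv s t : nle s t -> nle (sinv s) (sinv t).
Proof.
move=> [e ee ->]; rewrite sinvM (idem_sinv ee) (idem_mulC _ ee).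
by exists (sinv (sinv t) * e * sinv t) => //; exact: idem_conj.
Qed.

Lemma nle_idem e f : Idem e -> Idem f -> nle e f -> f * e = e.
Proof. by move=> _ ff [g _ ->]; rewrite mulgA ff. Qed.

Lemma nle_dom s t : nle s t -> nle (dom s) (dom t).
Proof. by move=> st; apply: nle_mul => //; exact: nle_sinv. Qed.

Lemma dom_mul_nle s t : nle (dom (s * t)) (dom t).
Proof.
exists (dom (s * t)); first exact: idem_dom.
by rewrite /dom sinvM !mulgA mulVgKs.
Qed.

Lemma ran_mul_nle s t : nle (ran (s * t)) (ran s).
Proof.
exists (ran (s * t)); first exact: idem_ran.
by rewrite /ran sinvM !mulgA mulgVKs.
Qed.

Lemma dom_mul s t : nle (ran t) (dom s) -> dom (s * t) = dom t.
Proof.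
move=> le; have E := nle_idem (idem_ran t) (idem_dom s) le.
rewrite /dom sinvM -!mulgA (mulgA (sinv s)).
by rewrite -{2}(ran_mulg t) (mulgA (sinv s * s)) E ran_mulg.
Qed.

End InverseSemigroupTheory.
Arguments Idem S : clear implicits.

Record category := Category {
  obj :> Type;
  hom : obj -> obj -> Type;
  idm : forall a, hom a a;
  cmp : forall a b c, hom b c -> hom a b -> hom a c;
  cmp1m : forall a b (f : hom a b), cmp (idm b) f = f;
  cmpm1 : forall a b (f : hom a b), cmp f (idm a) = f;
  cmpA : forall a b c d (h : hom c d) (g : hom b c) (f : hom a b),
    cmp h (cmp g f) = cmp (cmp h g) f
}.
Arguments idm {c} a : rename.

Notation "g \c f" := (cmp g f) (at level 40, left associativity).

Definition isomorphic (C : category) (a b : C) : Prop :=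
  exists (f : hom a b) (g : hom b a), g \c f = idm a /\ f \c g = idm b.

Record functor (C D : category) := Functor {
  fobj :> C -> D;
  fhom : forall a b, hom a b -> hom (fobj a) (fobj b);
  fhom1 : forall a, fhom (idm a) = idm (fobj a);
  fhomM : forall a b c (g : hom b c) (f : hom a b),
    fhom (g \c f) = fhom g \c fhom f
}.

Record natural (C D : category) (F G : functor C D) := Natural {
  napp :> forall a : C, hom (F a) (G a);
  nappE : forall a b (f : hom a b), napp b \c fhom F f = fhom G f \c napp a
}.

Section FunctorCategory.
Variables C D : category.

Lemma natural_eq (F G : functor C D) (u v : natural F G) :
  (forall a, u a = v a) -> u = v.
Proof.
case: u v => [u Hu] [v Hv] /= uv.
have {}uv : u = v by apply: functional_extensionality_dep.
by subst v; congr Natural; exact: Prop_irrelevance.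
Qed.

Definition natural_id (F : functor C D) : natural F F.
Proof. by exists (fun a => idm (F a)) => a b f; rewrite cmp1m cmpm1. Defined.

Definition natural_cmp (F G K : functor C D)
  (v : natural G K) (u : natural F G) : natural F K.
Proof.
exists (fun a => v a \c u a) => a b f.
by rewrite -cmpA nappE cmpA nappE -cmpA.
Defined.

Definition functor_category : category.
Proof.
exists (functor C D) (@natural C D) natural_id natural_cmp.
- by move=> F G u; apply: natural_eq => a /=; rewrite cmp1m.
- by move=> F G u; apply: natural_eq => a /=; rewrite cmpm1.
- by move=> F G K L w v u; apply: natural_eq => a /=; rewrite cmpA.
Defined.

End FunctorCategory.

Definition functor_id (C : category) : functor C C.
Proof. by exists (fun a => a) (fun a b f => f). Defined.

Definition functor_cmp (C D K : category) (G : functor D K) (F : functor C D) :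
  functor C K.
Proof.
exists (fun a => G (F a)) (fun a b f => fhom G (fhom F f)).
- by move=> a; rewrite !fhom1.
- by move=> a b c g f; rewrite !fhomM.
Defined.

Definition full_subcategory (C : category) (P : C -> Prop) : category.
Proof.
exists {a : C | P a} (fun a b => hom (sval a) (sval b))
  (fun a => idm (sval a)) (fun a b c g f => g \c f).
- by move=> a b f; rewrite cmp1m.
- by move=> a b f; rewrite cmpm1.
- by move=> a b c d h g f; rewrite cmpA.
Defined.

(* The functors F and G are mutually quasi-inverse: natural isomorphisms are
   isomorphisms in the category of endofunctors. *)
Definition equivalence_pair (C D : category)
    (F : functor C D) (G : functor D C) : Prop :=
  @isomorphic (functor_category C C) (functor_cmp G F) (functor_id C) /\
  @isomorphic (functor_category D D) (functor_cmp F G) (functor_id D).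

Section Loganathan.
Variable S : inverseSemigroupType.
Implicit Types e f : Idem S.

(* An element of [log_hom e f] is the arrow (f, s) with d(s) = e, r(s) <= f. *)
Record log_hom e f := LogHom {
  log_elt :> S;
  log_dom : dom log_elt = \val e;
  log_ran : nle (ran log_elt) (\val f)
}.

Lemma log_hom_eq e f (a b : log_hom e f) : a = b :> S -> a = b.
Proof.
case: a b => [a a1 a2] [b b1 b2] /= ab; subst b.
by congr LogHom; exact: Prop_irrelevance.
Qed.

Lemma log_id_dom e : dom (\val e) = \val e.
Proof. by apply: dom_idem; exact: set_mem (valP e). Qed.

Lemma log_id_ran e : nle (ran (\val e)) (\val e).
Proof. by rewrite (ran_idem (set_mem (valP e))); exact: nle_refl. Qed.

Definition log_id e : log_hom e e := LogHom (log_id_dom e) (log_id_ran e).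

Lemma log_cmp_dom e f g (a : log_hom f g) (b : log_hom e f) :
  dom (log_elt a * log_elt b) = \val e.
Proof. by rewrite dom_mul ?log_dom //; exact: log_ran. Qed.

Lemma log_cmp_ran e f g (a : log_hom f g) (b : log_hom e f) :
  nle (ran (log_elt a * log_elt b)) (\val g).
Proof. exact: nle_trans (ran_mul_nle _ _) (log_ran a). Qed.

Definition log_cmp e f g (a : log_hom f g) (b : log_hom e f) : log_hom e g :=
  LogHom (log_cmp_dom a b) (log_cmp_ran a b).

Definition loganathan : category.
Proof.
exists (Idem S) log_hom log_id log_cmp.
- move=> e f a; apply: log_hom_eq => /=.
  have E := nle_idem (idem_ran a) (set_mem (valP f)) (log_ran a).
  by rewrite -[in LHS](ran_mulg a) mulgA E ran_mulg.
- by move=> e f a; apply: log_hom_eq; rewrite /= -(log_dom a) mulg_dom.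
- by move=> e f g k a b c; apply: log_hom_eq; rewrite /= mulgA.
Defined.

End Loganathan.

(* g is only relevant on p @` U, where it is the inverse of p restricted to U. *)
Definition local_homeomorphism (E X : topologicalType) (p : E -> X) : Prop :=
  forall e : E, exists U : set E,
    [/\ open U, U e, open (p @` U) &
     exists g : X -> E, [/\ {within U, continuous p},
       {within p @` U, continuous g} & {in U, cancel p g}]].

Section Sheaves.
Variable X : topologicalType.

Record etale := Etale {
  espace :> topologicalType;
  eproj : espace -> X;
  eproj_local : local_homeomorphism eproj
}.

Record etale_map (E E' : etale) := EtaleMap {
  emap :> E -> E';
  emap_cont : continuous emap;
  emap_proj : forall e, eproj (emap e) = eproj e
}.

Lemma etale_map_eq (E E' : etale) (f g : etale_map E E') : f =1 g -> f = g.
Proof.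
case: f g => [f f1 f2] [g g1 g2] /= /funext fg; subst g.
by congr EtaleMap; exact: Prop_irrelevance.
Qed.

Definition etale_id (E : etale) : etale_map E E.
Proof. by exists id => // e; exact: cvg_id. Defined.

Definition etale_cmp (E E' E'' : etale)
  (g : etale_map E' E'') (f : etale_map E E') : etale_map E E''.
Proof.
exists (g \o f); last by move=> e /=; rewrite !emap_proj.
by move=> e; apply: continuous_comp; exact: emap_cont.
Defined.

Definition Sh : category.
Proof.
by exists etale etale_map etale_id etale_cmp => *; apply: etale_map_eq.
Defined.

End Sheaves.

Section PrincipalBundles.
Variables (C : category) (X : topologicalType).

Definition bundle_act (E : functor C (Sh X)) (c d : C) (a : hom c d)
  (y : espace (E c)) : espace (E d) := emap (fhom E a) y.

Definition PB1 (E : functor C (Sh X)) (x : X) : Prop :=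
  exists (c : C) (y : espace (E c)), eproj y = x.

Definition PB2 (E : functor C (Sh X)) (x : X) : Prop :=
  forall (c d : C) (y : espace (E c)) (z : espace (E d)),
    eproj y = x -> eproj z = x ->
    exists (b : C) (a : hom b c) (a' : hom b d) (w : espace (E b)),
      [/\ eproj w = x, bundle_act a w = y & bundle_act a' w = z].

Definition PB3 (E : functor C (Sh X)) (x : X) : Prop :=
  forall (c d : C) (a a' : hom c d) (y : espace (E c)),
    eproj y = x -> bundle_act a y = bundle_act a' y ->
    exists (b : C) (g : hom b c) (z : espace (E b)),
      [/\ eproj z = x, a \c g = a' \c g & bundle_act g z = y].

Definition principal (E : functor C (Sh X)) : Prop :=
  forall x, [/\ PB1 E x, PB2 E x & PB3 E x].

End PrincipalBundles.

Definition Prin (S : inverseSemigroupType) (X : topologicalType) : category :=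
  @full_subcategory (functor_category (loganathan S) (Sh X))
    (@principal (loganathan S) X).

Section PartialBijections.
Variable Y : Type.

Record pbij := PBij {
  pbij_fun :> Y -> option Y;
  pbij_inj : forall y y' z, pbij_fun y = Some z -> pbij_fun y' = Some z -> y = y'
}.

Lemma pbij_eq (f g : pbij) : f =1 g -> f = g.
Proof.
case: f g => [f f1] [g g1] /= /funext fg; subst g.
by congr PBij; exact: Prop_irrelevance.
Qed.

Definition pbij_cmp (f g : pbij) : pbij.
Proof.
exists (pcomp f g) => y y' z; rewrite /pcomp.
case E : (g y) => [u|] //= fu; case E' : (g y') => [u'|] //= fu'.
by apply: (pbij_inj E); rewrite E' (pbij_inj fu fu').
Defined.

Lemma pbij_cmpA : associative pbij_cmp.
Proof.
move=> f g h; apply: pbij_eq => y /=; rewrite /pcomp /=.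
by case: (h y).
Qed.

HB.instance Definition _ := gen_eqMixin pbij.
HB.instance Definition _ := gen_choiceMixin pbij.
(* The product f * g of the symmetric inverse semigroup is f after g. *)
HB.instance Definition _ := isSemigroup.Build pbij pbij_cmpA.

End PartialBijections.

Section SSets.
Variable S : inverseSemigroupType.

(* An S-set structure on Y, S-sets being assumed effective. *)
Record action (Y : Type) := Action {
  act : {multiplicative S -> pbij Y};
  act_effective : forall y, exists s, act s y
}.

Record sset := SSet {
  scarrier :> Type;
  saction : action scarrier
}.

Definition sset_equiv (Y Z : sset) : Prop :=
  exists2 f : Y -> Z, bijective f &
    forall s y, act (saction Z) s (f y) = omap f (act (saction Y) s y).

Section Restriction.
Variables (Y : Type) (mu : action Y) (A : set Y).
Hypothesis A_stable : forall s y z, A y -> act mu s y = Some z -> A z.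

Definition restr_fun (s : S) (y : A) : option A :=
  obind insub (act mu s (\val y)).

Lemma restr_funE s y : omap \val (restr_fun s y) = act mu s (\val y).
Proof.
rewrite /restr_fun; case E : (act mu s (\val y)) => [z|] //=.
have Az : z \in A by apply/mem_set/(A_stable _ E)/set_mem/(valP y).
by rewrite insubT.
Qed.

Lemma restr_funP s y z :
  restr_fun s y = Some z <-> act mu s (\val y) = Some (\val z).
Proof.
rewrite -restr_funE; case: (restr_fun s y) => [u|] //=; split => [[->]|[]] //.
by move/val_inj ->.
Qed.

Definition restr_pbij (s : S) : pbij A.
Proof.
exists (restr_fun s) => y y' z /restr_funP h /restr_funP h'.
exact/val_inj/(pbij_inj h h').
Defined.

Lemma restr_pbijM : {morph restr_pbij : s t / s * t}.
Proof.
move=> s t; apply: pbij_eq => y.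
have inj : injective (omap (\val : A -> Y)).
  by move=> [u|] [v|] //= [/val_inj ->].
apply: inj; rewrite [LHS]restr_funE gmulfM /= /pcomp.
rewrite -(restr_funE t y); case: (restr_fun t y) => [u|] //=.
by rewrite restr_funE.
Qed.

HB.instance Definition _ := isMultiplicative.Build S (pbij A) restr_pbij restr_pbijM.

Lemma restr_effective y : exists s, restr_pbij s y.
Proof.
have [s h] := act_effective mu (\val y); exists s.
by move: h; rewrite -restr_funE /=; case: restr_fun.
Qed.

Definition restr_sset : sset :=
  SSet (Action (act := restr_pbij : {multiplicative S -> pbij A}) restr_effective).

End Restriction.

Record closed_inverse_subsemigroup := ClosedSubsemigroup {
  csset :> set S;
  csM : forall s t, csset s -> csset t -> csset (s * t);
  csV : forall s, csset s -> csset (sinv s);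
  csU : upset csset = csset
}.

Section Cosets.
Variable H : closed_inverse_subsemigroup.

Definition coset_of (x : S) : set S := upset [set x * h | h in (H : set S)].

Definition is_coset : set (set S) :=
  [set K | exists2 x, (H : set S) (dom x) & K = coset_of x].

(* s . K = L, where K = (xH)^up; since L ranges over cosets, the action of s on K
   is defined exactly when (sxH)^up is a coset. *)
Definition coset_rel (s : S) (K L : is_coset) : Prop :=
  exists x, [/\ (H : set S) (dom x), \val K = coset_of x &
                \val L = coset_of (s * x)].

Lemma cs_up s t : (H : set S) s -> nle s t -> (H : set S) t.
Proof. by move=> Hs st; rewrite -(csU H); exists s. Qed.

Lemma coset_of_rep x h : (H : set S) h -> coset_of x (x * h).
Proof. by move=> Hh; exists (x * h); [exists h | exact: nle_refl]. Qed.

Lemma is_cosetP x : is_coset (coset_of x) <-> (H : set S) (dom x).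
Proof.
split=> [[y Hy xy]|]; last by exists x.
have : coset_of x x.
  exists (x * dom y); first by exists (dom y).
  by exists (dom y) => //; exact: idem_dom.
rewrite xy => -[_ [k Hk <-] le]; apply: cs_up (nle_dom le).
rewrite /dom sinvM -!mulgA (mulgA (sinv y)).
by apply: csM; [exact: csV | exact: csM].
Qed.

Lemma coset_of_mul s x y :
  coset_of x = coset_of y -> coset_of (s * x) = coset_of (s * y).
Proof.
suff sub u v : coset_of u = coset_of v -> coset_of (s * u) `<=` coset_of (s * v).
  by move=> xy; apply/seteqP; split; apply: sub.
move=> uv w [_ [h Hh <-] le].
have := coset_of_rep u Hh; rewrite uv => -[_ [k Hk <-] le'].
exists (s * v * k); first by exists k.
by apply: nle_trans le; rewrite -!mulgA; apply: nle_mul => //; exact: nle_refl.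
Qed.

Lemma coset_of_cancel s x :
  (H : set S) (dom (s * x)) -> coset_of (sinv s * (s * x)) = coset_of x.
Proof.
have -> : sinv s * (s * x) = x * dom (s * x).
  by rewrite /dom sinvM mulgA (idem_mulC _ (idem_dom s)) /dom !mulgA.
move: (dom (s * x)) (idem_dom (s * x)) => k kk Hk.
apply/seteqP; split=> w [_ [h Hh <-] le].
  by exists (x * (k * h)); [exists (k * h) => //; exact: csM | rewrite mulgA].
exists (x * k * h); first by exists h.
apply: nle_trans le; rewrite -mulgA; apply: nle_mul; first exact: nle_refl.
by rewrite (idem_mulC _ kk); exists (sinv h * k * h) => //; exact: idem_conj.
Qed.

Definition coset_fun (s : S) (K : is_coset) : option is_coset :=
  if pselect (exists L, coset_rel s K L) is left h then Some (sval (cid h))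
  else None.

Lemma coset_funP s K L : coset_fun s K = Some L <-> coset_rel s K L.
Proof.
rewrite /coset_fun; case: pselect => [h|nh]; last first.
  by split=> // KL; case: nh; exists L.
case: cid => M /= KM; split=> [[<-] //|].
case: KM => x [Hx Kx Mx] [y [Hy Ky Ly]]; congr Some; apply: val_inj.
by rewrite Mx Ly; apply: coset_of_mul; rewrite -Kx -Ky.
Qed.

Definition coset_pbij (s : S) : pbij is_coset.
Proof.
exists (coset_fun s) => K K' L /coset_funP [x [Hx Kx Lx]].
move=> /coset_funP [y [Hy Ky Ly]]; apply: val_inj; rewrite Kx Ky.
have HL := set_mem (valP L).
rewrite -(@coset_of_cancel s x); last by apply/is_cosetP; rewrite -Lx.
rewrite -(@coset_of_cancel s y); last by apply/is_cosetP; rewrite -Ly.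
by apply: coset_of_mul; rewrite -Lx -Ly.
Defined.

Lemma coset_pbijM : {morph coset_pbij : s t / s * t}.
Proof.
move=> s t; apply: pbij_eq => K /=; rewrite /pcomp /=.
have P L : coset_fun (s * t) K = Some L <->
           obind (coset_fun s) (coset_fun t K) = Some L.
  split=> [/coset_funP [x [Hx Kx Lx]]|].
    have HL : (H : set S) (dom (s * t * x)).
      by apply/is_cosetP; rewrite -Lx; exact: set_mem (valP L).
    have HM : is_coset (coset_of (t * x)).
      by apply/is_cosetP/(cs_up HL); rewrite -mulgA; exact: dom_mul_nle.
    have -> : coset_fun t K = Some (SigSub (mem_set HM)).
      by apply/coset_funP; exists x.
    apply/coset_funP; exists (t * x); split=> //; last by rewrite mulgA.
    exact/is_cosetP.
  case E : (coset_fun t K) => [M|] //= /coset_funP [y [Hy My Ly]].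
  case/coset_funP: E => x [Hx Kx Mx]; apply/coset_funP; exists x; split=> //.
  by rewrite Ly -mulgA; apply: coset_of_mul; rewrite -Mx -My.
case E : (coset_fun (s * t) K) => [L|]; first by apply/esym/P.
by case E' : (obind _ _) => [L|] //; move/P: E'; rewrite E.
Qed.

HB.instance Definition _ :=
  isMultiplicative.Build S (pbij is_coset) coset_pbij coset_pbijM.

Lemma coset_effective K : exists s, coset_pbij s K.
Proof.
have [x Hx Kx] := set_mem (valP K); exists (ran x).
suff /coset_funP /= -> : coset_rel (ran x) K K by [].
by exists x; rewrite ran_mulg.
Qed.

Definition coset_sset : sset :=
  SSet (Action (act := coset_pbij : {multiplicative S -> pbij is_coset})
    coset_effective).

End Cosets.

Definition idem_filter (F : set S) : Prop :=
  [/\ F `<=` Idem S, F !=set0,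
      forall e f, F e -> Idem S f -> nle e f -> F f &
      forall e f, F e -> F f -> F (e * f)].

Definition universal (Y : sset) : Prop :=
  exists (F : set S) (H : closed_inverse_subsemigroup),
    [/\ idem_filter F, (H : set S) = upset F & sset_equiv Y (coset_sset H)].

End SSets.

Section UniversalSSets.
Variables (S : inverseSemigroupType) (X : topologicalType).

Definition act_over (E : etale X) (mu : action S E) : Prop :=
  forall s e e', act mu s e = Some e' -> eproj e' = eproj e.

Definition stalk (E : etale X) (x : X) : set E := [set e | eproj e = x].

Lemma stalk_stable (E : etale X) (mu : action S E) (x : X) : act_over mu ->
  forall s e e', stalk x e -> act mu s e = Some e' -> stalk x e'.
Proof. by move=> ov s e e' ex h; rewrite /stalk /= (ov _ _ _ h). Qed.

Definition stalk_sset (E : etale X) (mu : action S E) (ov : act_over mu)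
  (x : X) : sset S := restr_sset (stalk_stable (x := x) ov).

(* In [U5] the map is restricted to its domain of definition, where the default
   value of [odflt] plays no role. *)
Record univ_sset := UnivSSet {
  uspace :> etale X;
  uact : action S uspace;
  U1 : forall x, exists2 e, stalk x e & exists s, act uact s e;
  U2 : forall s, open [set e | act uact s e];
  U3 : act_over uact;
  U4 : forall x, universal (stalk_sset U3 x);
  U5 : {within [set p : discrete_topology S * uspace | act uact p.1 p.2],
    continuous (fun p => odflt p.2 (act uact p.1 p.2))}
}.

Record univ_map (E E' : univ_sset) := UnivMap {
  umap :> etale_map E E';
  umap_act : forall s e e', act (uact E) s e = Some e' ->
    act (uact E') s (umap e) = Some (umap e')
}.

Lemma univ_map_eq (E E' : univ_sset) (f g : univ_map E E') :
  umap f = umap g -> f = g.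
Proof.
case: f g => [f f1] [g g1] /= fg; subst g.
by congr UnivMap; exact: Prop_irrelevance.
Qed.

Definition univ_id (E : univ_sset) : univ_map E E.
Proof. by exists (etale_id E). Defined.

Definition univ_cmp (E E' E'' : univ_sset)
  (g : univ_map E' E'') (f : univ_map E E') : univ_map E E''.
Proof.
exists (etale_cmp g f) => s e e' h.
exact/umap_act/umap_act.
Defined.

Definition Univ : category.
Proof.
exists univ_sset univ_map univ_id univ_cmp => *; apply: univ_map_eq;
  exact: etale_map_eq.
Defined.

End UniversalSSets.

(* Main.v *)
Require Import Defs.
From HB Require Import structures.
From mathcomp Require Import all_boot generic_quotient.
From mathcomp Require Import boolp classical_sets topology.

Set Implicit Arguments.
Unset Strict Implicit.
Unset Printing Implicit Defensive.

Local Open Scope classical_set_scope.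
Local Open Scope group_scope.
Local Open Scope quotient_scope.

(** The functor [rho] from universal [S]-sets to principal bundles is explicit:
    from [E] it builds the bundle whose sheaf at an idempotent [e] is the open
    subspace [D_e] of the points on which [e] acts, the arrow [(f, s)] being
    [y |-> s . y].  It is full, faithful and essentially surjective, and
    [tau] is the quasi-inverse that these properties provide
    ([full_faithful_equivalence]).

    Stalkwise everything rests on [universalP]: an [S]-set is universal exactly
    when it is a single orbit and every [s] fixing a point lies above an
    idempotent acting on that point.  The existence of a point, transitivity and
    the condition on stabilizers are then (PB1), (PB2) and (PB3) respectively,
    read in both directions ([rho_principal], [total_stalk_universal]).

    Full faithfulness ([rho_full_faithful]): the action is effective, so the
    [D_e] cover [E] and a morphism is determined by its restrictions to them.
    Conversely, if [s . y = z] with [y] in [D_c] and [z] in [D_d], then [y] and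
    [z] are the images of one point under two arrows with the same source, one
    given by an idempotent and one by an element below [s] ([span_of_act]).
    Naturality along this span shows that the components of a natural
    transformation agree on overlaps and that the glued map is equivariant.

    Essential surjectivity ([rho_essentially_surjective]): given a principal
    bundle [P], one relation on the points of all the sheaves [P c] does the
    whole work.  Let [point_rel s p q] mean that [p = a . w] and [q = a' . w] for
    arrows [a], [a'] with a common source, given by elements [t] and [s t].
    Principality makes these relations compose, inversion of [s] reverses them,
    and they grow with [s].  Hence relatedness by some idempotent is an
    equivalence relation, and [point_rel s] induces a partial bijection of the
    quotient depending multiplicatively on [s].  With the final topology for the
    maps [P c -> total], which turn out to be open and injective, the quotient is
    a universal [S]-set, and these maps identify [P c] with the domain of [c]. *)

(** * Equivalences of categories *)

Section Equivalences.
Variables C D : category.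

Definition full_faithful (F : functor D C) : Prop :=
  forall (a b : D) (f : hom (F a) (F b)), exists! g : hom a b, fhom F g = f.

Definition essentially_surjective (F : functor D C) : Prop :=
  forall c : C, exists d : D, isomorphic (F d) c.

Lemma natural_isomorphic (F G : functor C D) (u : natural F G) :
    (forall a, exists v : hom (G a) (F a),
       v \c u a = idm (F a) /\ u a \c v = idm (G a)) ->
  @isomorphic (functor_category C D) F G.
Proof.
move=> /(_ _)/cid u_iso; pose v a := sval (u_iso a).
have vu a : v a \c u a = idm (F a) := (svalP (u_iso a)).1.
have uv a : u a \c v a = idm (G a) := (svalP (u_iso a)).2.
have nat_v a b (f : hom a b) : v b \c fhom G f = fhom F f \c v a.
  by rewrite -[LHS]cmpm1 -uv -cmpA [fhom G f \c _]cmpA -nappE -cmpA cmpA vu cmp1m.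
by exists u, (Natural nat_v); split; apply: natural_eq => a /=.
Qed.

End Equivalences.

(** The quasi-inverse sends [c] to a chosen object of [D] over it, and an arrow
    to the unique preimage of its conjugate by the chosen isomorphisms;
    uniqueness of preimages gives functoriality and naturality. *)
Lemma full_faithful_equivalence (C D : category) (F : functor D C) :
    full_faithful F -> essentially_surjective F ->
  exists G : functor C D, equivalence_pair G F.
Proof.
move=> /(_ _ _ _)/cid ff /(_ _)/cid es.
pose G0 c := sval (es c).
have /(_ _)/cid es_e c : exists e : hom (F (G0 c)) c, exists e',
    e' \c e = idm (F (G0 c)) /\ e \c e' = idm c by exact: svalP (es c).
pose e c := sval (es_e c); have /(_ _)/cid es_e' c := svalP (es_e c).
pose e' c := sval (es_e' c).
have e'e c : e' c \c e c = idm (F (G0 c)) := (svalP (es_e' c)).1.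
have ee' c : e c \c e' c = idm c := (svalP (es_e' c)).2.
pose lift a b f := sval (ff a b f).
have liftP a b f : fhom F (@lift a b f) = f := (svalP (ff a b f)).1.
have F_inj a b (g h : hom a b) : fhom F g = fhom F h -> g = h.
  by move=> gh; have [k [_ uk]] := ff a b (fhom F h); rewrite -(uk _ gh) -(uk _ erefl).
pose G1 a b (f : hom a b) := @lift (G0 a) (G0 b) (e' b \c f \c e a).
have G1_id a : G1 _ _ (idm a) = idm (G0 a).
  by apply: F_inj; rewrite liftP cmpm1 e'e fhom1.
have G1_cmp a b c (g : hom b c) (f : hom a b) :
    G1 _ _ (g \c f) = G1 _ _ g \c G1 _ _ f.
  apply: F_inj; rewrite fhomM !liftP -!cmpA; congr (_ \c (_ \c _)).
  by rewrite !cmpA ee' cmp1m.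
pose G := Functor G1_id G1_cmp.
exists G; split.
  have nat_e a b (f : hom a b) :
      e b \c fhom (functor_cmp F G) f = fhom (functor_id C) f \c e a.
    by rewrite /= liftP !cmpA ee' cmp1m.
  pose eta := @Natural C C (functor_cmp F G) (functor_id C) e nat_e.
  apply: (natural_isomorphic (u := eta)) => a; exists (e' a).
  by split; [exact: e'e | exact: ee'].
pose k d : hom (G (F d)) d := lift _ _ (e (F d)).
have nat_k a b (f : hom a b) :
    k b \c fhom (functor_cmp G F) f = fhom (functor_id D) f \c k a.
  by apply: F_inj; rewrite !fhomM !liftP !cmpA ee' cmp1m.
pose k' d : hom d (G (F d)) := lift _ _ (e' (F d)).
have k'k d : k' d \c k d = idm (G (F d)).
  by apply: F_inj; rewrite fhomM !liftP fhom1 e'e.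
have kk' d : k d \c k' d = idm d by apply: F_inj; rewrite fhomM !liftP fhom1 ee'.
pose eps := @Natural D D (functor_cmp G F) (functor_id D) k nat_k.
apply: (natural_isomorphic (u := eps)) => d; exists (k' d).
by split; [exact: k'k | exact: kk'].
Qed.

(** * Local homeomorphisms and étale spaces *)

Section LocalHomeomorphisms.
Variables E X : topologicalType.
Implicit Types p : E -> X.

Definition locally_injective p : Prop :=
  forall e, exists U : set E, [/\ open U, U e & {in U &, injective p}].

Definition open_map p : Prop := forall V, open V -> open (p @` V).

Lemma within_openP (Y Z : topologicalType) (A : set Y) (f : Y -> Z) : open A ->
  {within A, continuous f} <-> forall V, open V -> open (A `&` f @^-1` V).
Proof.
move=> oA; rewrite continuous_open_subspace//; split=> [cf V oV|cf y /set_mem Ay].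
  rewrite openE => y [Ay Vy]; apply: filterI; first exact: open_nbhs_nbhs.
  by apply: (cf y (mem_set Ay)); exact: open_nbhs_nbhs.
move=> W; rewrite nbhsE => -[V [oV Vy] VW].
apply: filterS (open_nbhs_nbhs (conj (cf V oV) (conj Ay Vy))).
by move=> z [_ /VW].
Qed.

(** In this form the property passes to open subspaces and to glued spaces
    without choosing local inverses again. *)
Lemma local_homeomorphismP p :
  local_homeomorphism p <-> [/\ continuous p, open_map p & locally_injective p].
Proof.
split=> [lh|[cp op ip] e].
  split.
  - move=> e; have [U [oU Ue _ [g [+ _ _]]]] := lh e.
    by rewrite continuous_open_subspace// => /(_ e (mem_set Ue)).
  - move=> V oV; rewrite openE => _ [e Ve <-].
    have [U [oU Ue opU [g [_ cg gK]]]] := lh e.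
    have oW := (within_openP _ opU).1 cg _ (openI oU oV).
    apply: filterS (open_nbhs_nbhs (conj oW _)).
      by move=> _ [[u Uu <-]]; rewrite /= gK ?inE// => -[_ Vu]; exists u.
    by split=> /=; [exists e | rewrite gK ?inE].
  - move=> e; have [U [oU Ue _ [g [_ _ gK]]]] := lh e.
    by exists U; split=> // x y Ux Uy; exact: can_in_inj gK x y Ux Uy.
have [U [oU Ue injU]] := ip e.
have /choice[g gP] : forall x, exists y, (p @` U) x -> U y /\ p y = x.
  move=> x; have [[u Uu <-]|nx] := pselect ((p @` U) x); first by exists u.
  by exists e => /nx.
have gK u : U u -> g (p u) = u.
  move=> Uu; have [|Ug pg] := gP (p u); first by exists u.
  by apply: injU pg; rewrite inE.
exists U; split=> //; first exact: op.
exists g; split; first exact: continuous_subspaceT.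
  apply/within_openP; [exact: op | move=> V oV].
  suff -> : p @` U `&` g @^-1` V = p @` (U `&` V) by exact/op/openI.
  apply/seteqP; split=> [_ [[u Uu <-] /=]|_ [u [Uu Vu] <-]].
    by rewrite gK// => Vu; exists u.
  by split; [exists u | rewrite /= gK].
by move=> u /set_mem; exact: gK.
Qed.

End LocalHomeomorphisms.

Section EtaleMaps.
Variable X : topologicalType.
Implicit Types E : etale X.

(** Let [U] be a neighbourhood of [f e] on which the projection is injective.
    Inside [U], the image of [V] contains all the points that lie over the
    projection of [V `&` f @^-1` U], which is open. *)
Lemma etale_map_open E E' (f : etale_map E E') : open_map f.
Proof.
have [_ op _] := (local_homeomorphismP _).1 (eproj_local (e := E)).
have [cp' _ ip'] := (local_homeomorphismP _).1 (eproj_local (e := E')).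
move=> V oV; rewrite openE => _ [e Ve <-].
have [U [oU Ue injU]] := ip' (f e).
have oW : open (V `&` f @^-1` U).
  by apply: openI oV _; apply: (continuousP _).1 oU; exact: emap_cont.
have oU' := openI oU ((continuousP _).1 cp' _ (op _ oW)).
apply: filterS (open_nbhs_nbhs (conj oU' _)).
  move=> z [Uz [v [Vv Uv] pv]]; exists v => //.
  by apply: injU; rewrite ?inE// emap_proj.
by split=> //=; exists e => //; rewrite emap_proj.
Qed.

Lemma etale_bijective_iso E E' (f : etale_map E E') : bijective f ->
  exists g : @hom (Sh X) E' E, g \c (f : @hom (Sh X) E E') = idm (E : Sh X) /\
     (f : @hom (Sh X) E E') \c g = idm (E' : Sh X).
Proof.
move=> [g fK gK].
have cg : continuous g.
  apply/continuousP => V oV; suff -> : g @^-1` V = f @` V by exact: etale_map_open.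
  apply/seteqP; split=> [y Vy|_ [v Vv <-]]; last by rewrite /= fK.
  by exists (g y).
have pg e : eproj (g e) = eproj e by rewrite -[in RHS](gK e) emap_proj.
by exists (EtaleMap cg pg); split; apply: etale_map_eq.
Qed.

Lemma sub_etale_local E (D : set E) : open D ->
  local_homeomorphism (fun y : D => eproj (\val y)).
Proof.
move=> oD; have [cp op ip] := (local_homeomorphismP _).1 (eproj_local (e := E)).
have cval : continuous (\val : D -> E) by exact: initial_continuous.
apply/local_homeomorphismP; split.
- by move=> y; apply: continuous_comp; [exact: cval | exact: cp].
- move=> _ [W oW <-].
  suff -> : (fun y : D => eproj (\val y)) @` (\val @^-1` W) =
      eproj (e := E) @` (D `&` W) by exact/op/openI.
  apply/seteqP; split=> [_ [y Wy <-]|_ [y [Dy Wy] <-]].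
    by exists (\val y) => //; split=> //; exact: set_mem (valP y).
  by exists (SigSub (mem_set Dy)).
- move=> y; have [U [oU Uy injU]] := ip (\val y).
  exists (\val @^-1` U); split=> //; first exact: (continuousP _).1 cval _ oU.
  by move=> a b; rewrite !inE => Ua Ub /injU/val_inj; apply; rewrite inE.
Qed.

Definition sub_etale E (D : set E) (oD : open D) : etale X :=
  Etale (sub_etale_local oD).

End EtaleMaps.

(** * The natural order and actions *)

Section NaturalOrder.
Variable S : inverseSemigroupType.
Implicit Types s t e : S.

Lemma nle_mul_dom s t : nle s t -> s = t * dom s.
Proof.
move=> [e ee ->]; rewrite /dom sinvM (idem_sinv ee).
have -> : e * sinv t * (t * e) = dom t * e.
  by rewrite (mulgA (e * _)) -(mulgA e) -/(dom t) (idemC ee (idem_dom t)) -mulgA ee.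
by rewrite mulgA mulg_dom.
Qed.

Lemma nle_dom_eq s t : nle s t -> dom s = dom t -> s = t.
Proof. by move=> /nle_mul_dom + st; rewrite st mulg_dom. Qed.

Lemma idem_mul_nle e s : Idem S e -> nle (e * s) s.
Proof.
by move=> ee; rewrite idem_mulC//; exists (sinv s * e * s) => //; exact: idem_conj.
Qed.

Lemma nle_idem_idem e s : Idem S e -> nle s e -> Idem S s.
Proof. by move=> ee [f ff ->]; exact: idem_mul. Qed.

(** The equality [dom (s * t) = dom t] means that [s] is defined on the whole
    range of [t]: this recovers composability from a computation of domains. *)
Lemma dom_mul_fix s t : dom (s * t) = dom t -> dom s * t = t.
Proof.
move=> st; apply: nle_dom_eq; first exact/idem_mul_nle/idem_dom.
rewrite -st {1}/dom sinvM (idem_sinv (idem_dom s)) -mulgA (mulgA (dom s)).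
rewrite (idem_dom s).
by rewrite /dom sinvM !mulgA.
Qed.

End NaturalOrder.

Section Actions.
Variables (S : inverseSemigroupType) (Y : Type) (mu : action S Y).
Implicit Types (s t e : S) (y z : Y).

Lemma act_some s y : act mu s y -> exists z, act mu s y = Some z.
Proof. by case: (act mu s y) => [z|] // _; exists z. Qed.

Lemma actM s t y z w :
  act mu t y = Some z -> act mu s z = Some w -> act mu (s * t) y = Some w.
Proof. by move=> ty sz; rewrite gmulfM /= /pcomp /= ty. Qed.

Lemma actM_inv s t y w : act mu (s * t) y = Some w ->
  exists2 z, act mu t y = Some z & act mu s z = Some w.
Proof. by rewrite gmulfM /= /pcomp /=; case: (act mu t y) => // z; exists z. Qed.

Lemma act_idem e y z : Idem S e -> act mu e y = Some z -> z = y.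
Proof.
move=> ee ey; have := ey; rewrite -{1}ee => /actM_inv[u]; rewrite ey => -[<-] ez.
exact: (pbij_inj ez ey).
Qed.

Lemma act_sinv s y z : act mu s y = Some z -> act mu (sinv s) z = Some y.
Proof.
move=> sy; have := sy; rewrite -{1}(mulgVKs s) -mulgA => /actM_inv[u].
move=> /[dup] du /act_idem -> //; last exact: idem_dom.
move=> _; move: du => /actM_inv[v]; rewrite sy => -[<-] sz; rewrite sz.
by congr Some; apply: act_idem (actM sy sz); exact: idem_dom.
Qed.

Lemma act_nle s t y z : nle s t -> act mu s y = Some z -> act mu t y = Some z.
Proof. by move=> [e ee ->] /actM_inv[u /act_idem ->]. Qed.

Lemma act_dom s y z : act mu s y = Some z -> act mu (dom s) y = Some y.
Proof. by move=> sy; exact: actM sy (act_sinv sy). Qed.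

Lemma act_defined s y : act mu (dom s) y = Some y -> exists z, act mu s y = Some z.
Proof. by move=> /actM_inv[z sy _]; exists z. Qed.

End Actions.

(** * Universal S-sets *)

Section Universal.
Variable S : inverseSemigroupType.

(** An intrinsic form of universality, with no reference to cosets. The last
    condition replaces freeness of a torsor: the stabilizer of a point is as
    small as it can be, namely generated upwards by its idempotents. *)
Definition idem_stabilized_orbit (Y : sset S) : Prop :=
  [/\ inhabited Y,
      forall y z : Y, exists s, act (saction Y) s y = Some z &
      forall s (y : Y), act (saction Y) s y = Some y ->
        exists e, [/\ Idem S e, nle e s & act (saction Y) e y = Some y]].

Lemma idem_stabilized_orbit_equiv (Y Z : sset S) : sset_equiv Y Z ->
  idem_stabilized_orbit Z -> idem_stabilized_orbit Y.
Proof.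
move=> [f [g fK gK] fact] [[z] tr fr].
have fact' s y y' : act (saction Z) s (f y) = Some (f y') ->
    act (saction Y) s y = Some y'.
  rewrite fact; case: (act (saction Y) s y) => [u|] // [fu].
  by congr Some; apply: (can_inj fK).
split; first exact: inhabits (g z).
- by move=> y y'; have [s sy] := tr (f y) (f y'); exists s; exact: fact'.
- move=> s y sy; have [|e [ee es ey]] := fr s (f y); first by rewrite fact sy.
  by exists e; split=> //; exact: fact'.
Qed.

Section CosetsOfFilter.
Variables (F : set S) (H : closed_inverse_subsemigroup S).
Hypotheses (F_filter : idem_filter F) (HF : (H : set S) = upset F).

Let H_idem e : F e -> (H : set S) e.
Proof. by move=> Fe; rewrite HF; exists e => //; exact: nle_refl. Qed.

Lemma coset_of_mulr x h : (H : set S) h -> Idem S h ->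
  coset_of H (x * h) = coset_of H x.
Proof.
move=> Hh hh; apply/seteqP; split=> w [_ [k Hk <-] le].
  by exists (x * (h * k)); [exists (h * k) => //; exact: csM | rewrite mulgA].
exists (x * h * k); first by exists k.
apply: nle_trans le; rewrite -mulgA; apply: nle_mul; first exact: nle_refl.
exact: idem_mul_nle.
Qed.

Lemma coset_sset_orbit : idem_stabilized_orbit (coset_sset H).
Proof.
have [FI [e Fe] _ _] := F_filter; split.
- have cK : is_coset H (coset_of H e).
    by apply/is_cosetP; rewrite dom_idem; [exact: H_idem | exact: FI].
  exact: inhabits (SigSub (mem_set cK)).
- move=> K L; have [x Hx Kx] := set_mem (valP K).
  have [z Hz Lz] := set_mem (valP L).
  exists (z * sinv x); apply/coset_funP; exists x; split=> //.
  rewrite Lz -mulgA -/(dom x) coset_of_mulr //; exact: idem_dom.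
- move=> s K /coset_funP[x [Hx Kx sKx]].
  have xs : coset_of H (s * x) = coset_of H x by rewrite -Kx -sKx.
  have [_ [h + <-] le] : coset_of H (s * x) x.
    by rewrite xs; have := coset_of_rep x Hx; rewrite mulg_dom.
  rewrite HF => -[f Ff fh]; have ff := FI _ Ff.
  (* [s] sends the idempotent [x f x^-1] to an element below [x x^-1], that is,
     to an idempotent; it is below [s] and still fixes the coset of [x]. *)
  have sxf_x : nle (s * x * f) x.
    by apply: nle_trans le; apply: nle_mul fh; exact: nle_refl.
  have k_idem : Idem S (x * f * sinv x).
    by have := idem_conj (sinv x) ff; rewrite sinvK.
  have sk : s * (x * f * sinv x) = s * x * f * sinv x by rewrite !mulgA.
  exists (s * (x * f * sinv x)); split; last 1 first.
  - apply/coset_funP; exists x; split=> //; rewrite Kx -xs.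
    have -> : s * (x * f * sinv x) * x = s * x * f.
      rewrite sk -mulgA -/(dom x) -mulgA (idemC ff (idem_dom x)) mulgA.
      by rewrite -[s * x * dom x]mulgA mulg_dom.
    by rewrite [RHS]coset_of_mulr //; exact: H_idem.
  - rewrite sk; apply: (nle_idem_idem (idem_ran x)).
    by apply: nle_mul sxf_x _; exact: nle_refl.
  - by exists (x * f * sinv x).
Qed.

End CosetsOfFilter.

Section StabilizerCosets.
Variables (Y : sset S) (y : Y).
Hypothesis Y_orbit : idem_stabilized_orbit Y.
Let mu := saction Y.

Let stab : set S := [set s | act mu s y = Some y].

Lemma stabM s t : stab s -> stab t -> stab (s * t).
Proof. by move=> sy ty; exact: actM ty sy. Qed.

Lemma stabV s : stab s -> stab (sinv s).
Proof. exact: act_sinv. Qed.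

Lemma stabU : upset stab = stab.
Proof.
apply/seteqP; split=> [t [s sy st]|s sy]; first exact: act_nle st sy.
by exists s => //; exact: nle_refl.
Qed.

Definition stabilizer := ClosedSubsemigroup stabM stabV stabU.

Lemma stabilizer_filter :
  exists2 F, idem_filter F & (stabilizer : set S) = upset F.
Proof.
have [_ _ fr] := Y_orbit.
exists (stab `&` Idem S).
  split; first by move=> e [].
  - have [s sy] := act_effective mu y.
    have [z sz] := act_some sy.
    by exists (dom s); split; [exact: act_dom sz | exact: idem_dom].
  - by move=> e f [ey _] ff ef; split=> //; exact: act_nle ef ey.
  - by move=> e f [ey ee] [fy ff]; split; [exact: stabM | exact: idem_mul].
apply/seteqP; split=> [s sy|s [e [ey _] es]]; last exact: act_nle es ey.
by have [e [ee es ey]] := fr s y sy; exists e.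
Qed.

(** As for transitive actions of groups, cosets of the stabilizer of [y] are the
    sets of elements carrying [y] to a given point. *)
Lemma coset_of_stabilizer s z : act mu s y = Some z ->
  coset_of stabilizer s = [set t | act mu t y = Some z].
Proof.
move=> sy; apply/seteqP; split=> [t [_ [h Hh <-] le]|t ty] /=.
  by apply: act_nle le _; exact: actM Hh sy.
exists (s * (sinv s * t)).
  by exists (sinv s * t) => //; exact: actM ty (act_sinv sy).
by rewrite mulgA; exact/idem_mul_nle/idem_ran.
Qed.

Lemma stabilizer_equiv : sset_equiv Y (coset_sset stabilizer).
Proof.
have [_ tr _] := Y_orbit.
have coset_z z : is_coset stabilizer [set t | act mu t y = Some z].
  have [s sy] := tr y z; exists s; last by rewrite (coset_of_stabilizer sy).
  exact: act_dom sy.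
pose f z : coset_sset stabilizer := SigSub (mem_set (coset_z z)).
have f_inj : injective f.
  move=> z w [zw]; have [s sz] := tr y z.
  have : [set t | act mu t y = Some z] s by [].
  by rewrite zw /= sz => -[].
have /choice[g gK] : forall K, exists z, f z = K.
  move=> K; have [x Hx Kx] := set_mem (valP K).
  have [z xz] := act_defined Hx.
  by exists z; apply: val_inj; rewrite Kx (coset_of_stabilizer xz).
have fK : cancel f g by move=> z; apply: f_inj; rewrite gK.
exists f; first by exists g.
move=> s z.
case sz : (act (saction Y) s z) => [w|] /=.
  have [x xz] := tr y z; apply/coset_funP; exists x; split => /=.
  - exact: act_dom xz.
  - by rewrite (coset_of_stabilizer xz).
  - by rewrite (coset_of_stabilizer (actM xz sz)).
case E : (coset_fun s (f z)) => [L|] //; case/coset_funP: E => x [Hx /= zx Lx].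
have [z' xz] := act_defined Hx.
move: zx; rewrite (coset_of_stabilizer xz) => zz'.
have xz' : [set t | act mu t y = Some z] x by rewrite zz'.
have Hsx : (stabilizer : set S) (dom (s * x)).
  by apply/is_cosetP; rewrite -Lx; exact: set_mem (valP L).
have [w sxy] := act_defined Hsx; have [u + +] := actM_inv sxy.
by rewrite xz' => -[<-]; rewrite -/mu sz.
Qed.

End StabilizerCosets.

(** Such an orbit is the coset space of the stabilizer of any of its points, the
    filter consisting of the idempotents of that stabilizer. *)
Lemma universalP (Y : sset S) : universal Y <-> idem_stabilized_orbit Y.
Proof.
split=> [[F [H [FF HF YH]]]|oY].
  by apply: idem_stabilized_orbit_equiv YH _; exact: coset_sset_orbit HF.
have [[y] _ _] := oY; have [F FF HF] := @stabilizer_filter Y y oY.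
by exists F, (stabilizer y); split=> //; exact: stabilizer_equiv.
Qed.

End Universal.

(** * The bundle of a universal S-set *)

Section Continuity.
Variables (S : inverseSemigroupType) (X : topologicalType).

Lemma open_discrete_prod (T : choiceType) (Y : topologicalType)
    (W : set (discrete_topology T * Y)) :
  open W <-> forall t, open [set y | W (t, y)].
Proof.
split=> [oW t|oW].
  have ct : continuous (fun y : Y => (t, y) : discrete_topology T * Y).
    move=> y U [[A B] [/= /nbhs_singleton At By] AB].
    by apply: filterS By => z Bz; exact: AB.
  exact: (continuousP _).1 ct _ oW.
rewrite openE => -[t y] Wty; exists ([set t], [set y | W (t, y)]).
  split=> /=; last exact: open_nbhs_nbhs.
  by rewrite /nbhs /= /principal_filter => u ->.
by move=> [u z] /= [-> ].
Qed.

(** Since [S] is discrete, joint continuity of the action means continuity of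
    each partial map [y |-> s . y] on its open domain. *)
Lemma act_continuousP (E : etale X) (mu : action S E) :
    (forall s, open [set y | act mu s y]) ->
  {within [set p : discrete_topology S * E | act mu p.1 p.2],
     continuous (fun p => odflt p.2 (act mu p.1 p.2))} <->
  forall s V, open V -> open [set y | exists2 z, act mu s y = Some z & V z].
Proof.
move=> dom_open.
have oA : open [set p : discrete_topology S * E | act mu p.1 p.2].
  by apply/open_discrete_prod => s; exact: dom_open.
have slice s V : [set y | exists2 z, act mu s y = Some z & V z] =
    [set y | act mu s y /\ V (odflt y (act mu s y))].
  apply/seteqP; split=> y /=; first by move=> [z -> Vz].
  by case: (act mu s y) => [z|] [] // _ Vz; exists z.
split=> [/(within_openP _ oA) + s V oV|aV].
  by rewrite slice => /(_ V oV)/open_discrete_prod/(_ s).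
apply/(within_openP _ oA) => V oV; apply/open_discrete_prod => s.
by have := aV s V oV; rewrite slice.
Qed.

End Continuity.

Section Rho.
Variables (S : inverseSemigroupType) (X : topologicalType).

Lemma stalk_actP (E : etale X) (mu : action S E) (ov : act_over mu) x s
    (y z : @stalk X E x) :
  act (saction (stalk_sset ov x)) s y = Some z <->
  act mu s (\val y) = Some (\val z).
Proof. exact: restr_funP (stalk_stable ov) s y z. Qed.

Section RhoObject.
Variable E : univ_sset S X.
Let mu := uact E.

Definition idem_domain (e : loganathan S) : etale X :=
  sub_etale (U2 E (\val (e : Idem S))).

Lemma idem_domainP (e : loganathan S) (y : idem_domain e) :
  act mu (\val (e : Idem S)) (\val y) = Some (\val y).
Proof.
have [z ey] := act_some (set_mem (valP y)).
by rewrite ey (act_idem (set_mem (valP (e : Idem S))) ey).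
Qed.

Lemma idem_domain_in (e : Idem S) y : act mu (\val e) y = Some y ->
  exists y' : idem_domain e, \val y' = y.
Proof.
move=> ey; have ye : y \in [set y | act mu (\val e) y] by rewrite inE /= ey.
by exists (SigSub ye).
Qed.

Lemma arrow_defined (e f : loganathan S) (a : hom e f) (y : idem_domain e) :
  exists z : idem_domain f,
    act mu (log_elt (a : log_hom _ _)) (\val y) = Some (\val z).
Proof.
case: a => s ds rs; rewrite [log_elt _]/=.
have dy : act mu (dom s) (\val y) = Some (\val y) by rewrite ds; exact: idem_domainP.
have [z sy] := act_defined dy.
have fz : act mu (\val (f : Idem S)) z = Some z.
  by apply: act_nle rs _; exact: actM (act_sinv sy) sy.
by have [z' z'z] := idem_domain_in fz; exists z'; rewrite z'z.
Qed.

Definition arrow_fun (e f : loganathan S) (a : hom e f) (y : idem_domain e) :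
  idem_domain f := sval (cid (arrow_defined a y)).

Lemma arrow_funP (e f : loganathan S) (a : hom e f) y :
  act mu (log_elt (a : log_hom _ _)) (\val y) = Some (\val (arrow_fun a y)).
Proof. by rewrite /arrow_fun; case: cid. Qed.

Lemma arrow_funE (e f : loganathan S) (a : hom e f) y z :
  act mu (log_elt (a : log_hom _ _)) (\val y) = Some (\val z) ->
  arrow_fun a y = z.
Proof. by rewrite arrow_funP => -[/val_inj]. Qed.

Lemma arrow_fun_cont (e f : loganathan S) (a : hom e f) :
  continuous (arrow_fun a).
Proof.
apply/continuousP => _ [V oV <-].
have oaV := (act_continuousP (U2 E)).1 (@U5 _ _ E) (log_elt (a : log_hom _ _)) V oV.
exists [set y | exists2 z, act mu (log_elt (a : log_hom _ _)) y = Some z & V z] => //.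
apply/seteqP; split=> y /=; first by move=> [z]; rewrite arrow_funP => -[<-].
by exists (\val (arrow_fun a y)) => //; exact: arrow_funP.
Qed.

Lemma arrow_fun_proj (e f : loganathan S) (a : hom e f) y :
  eproj (arrow_fun a y) = eproj y.
Proof. exact: U3 (arrow_funP a y). Qed.

Definition rho_arrow (e f : loganathan S) (a : hom e f) :
    @hom (Sh X) (idem_domain e) (idem_domain f) :=
  EtaleMap (arrow_fun_cont (a := a)) (arrow_fun_proj a).

Lemma rho_arrow1 (e : loganathan S) :
  rho_arrow (idm e) = idm (idem_domain e : Sh X).
Proof. by apply: etale_map_eq => y; apply: arrow_funE; exact: idem_domainP. Qed.

Lemma rho_arrowM (e f g : loganathan S) (b : hom f g) (a : hom e f) :
  rho_arrow (b \c a) = rho_arrow b \c rho_arrow a.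
Proof.
apply: etale_map_eq => y; apply: arrow_funE.
exact: actM (arrow_funP a y) (arrow_funP b _).
Qed.

Definition rho_functor : functor (loganathan S) (Sh X) :=
  Functor rho_arrow1 rho_arrowM.

Lemma stalk_act_orbit x (y z : @stalk X E x) :
  exists s, act mu s (\val y) = Some (\val z).
Proof.
have [_ tr _] := (universalP _).1 (U4 E x).
by have [s /stalk_actP sy] := tr y z; exists s.
Qed.

Lemma act_fix s y : act mu s y = Some y ->
  exists e, [/\ Idem S e, nle e s & act mu e y = Some y].
Proof.
move=> sy; have [_ _ fr] := (universalP _).1 (U4 E (eproj y)).
have yx : y \in @stalk X E (eproj y) by rewrite inE.
have [|e [ee es /stalk_actP ey]] := fr s (SigSub yx); first exact/stalk_actP.
by exists e.
Qed.

(** The element [t = d s c] still sends [y] to [z], and its domain [t^-1 t] lies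
    below [c] and its range below [d]. The span is [t^-1 t] and [t], applied to
    [y] seen as a point of the domain of [t^-1 t]. *)
Lemma span_of_act (c d : loganathan S) (y : idem_domain c) (z : idem_domain d) s :
    act mu s (\val y) = Some (\val z) ->
  exists b (a : hom b c) (a' : hom b d) (w : idem_domain b),
    [/\ arrow_fun a w = y, arrow_fun a' w = z,
        Idem S (log_elt (a : log_hom _ _)) & nle (log_elt (a' : log_hom _ _)) s].
Proof.
move=> sy; have cc : Idem S (\val (c : Idem S)) := set_mem (valP (c : Idem S)).
have dd : Idem S (\val (d : Idem S)) := set_mem (valP (d : Idem S)).
pose t := \val (d : Idem S) * s * \val (c : Idem S).
have ts : nle t s.
  apply: (nle_trans (t := s * \val (c : Idem S))); last by exists (\val (c : Idem S)).
  by rewrite /t -mulgA; exact: idem_mul_nle.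
have ty : act mu t (\val y) = Some (\val z).
  by apply: actM (idem_domainP y) _; exact: actM sy (idem_domainP z).
have tc : nle (ran (dom t)) (\val (c : Idem S)).
  rewrite (ran_idem (idem_dom t)) -[X in nle _ X](dom_idem cc).
  exact: dom_mul_nle.
have td : nle (ran t) (\val (d : Idem S)).
  by rewrite -[X in nle _ X](ran_idem dd) /t -mulgA; exact: ran_mul_nle.
pose b : Idem S := SigSub (mem_set (idem_dom t)).
have [w wy] := @idem_domain_in b _ (act_dom ty).
exists b, (@LogHom S b c (dom t) (dom_idem (idem_dom t)) tc).
exists (@LogHom S b d t erefl td), w; split=> //; [| |exact: idem_dom].
- by apply: arrow_funE; rewrite /= wy; exact: act_dom ty.
- by apply: arrow_funE; rewrite /= wy.
Qed.

(** For two points in one stalk, transitivity gives [s] carrying one to the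
    other, and [span_of_act] turns it into the span of (PB2). For (PB3), two
    parallel arrows [s] and [s'] that agree on [y] are compared through
    [s'^-1 s], which fixes [y]. *)
Lemma rho_principal : principal rho_functor.
Proof.
move=> x; split.
- have [y yx [s sy0]] := U1 E x; have [z sy] := act_some sy0.
  have [y' y'y] :=
    @idem_domain_in (SigSub (mem_set (idem_dom s))) y (act_dom sy).
  by exists (SigSub (mem_set (idem_dom s))), y'; rewrite /= y'y.
- move=> c d y z yx zx.
  have yx' : \val y \in @stalk X E x by rewrite inE.
  have zx' : \val z \in @stalk X E x by rewrite inE.
  have [s sy] := @stalk_act_orbit x (SigSub yx') (SigSub zx'); rewrite /= in sy.
  have [b [a [a' [w [wy wz _ _]]]]] := span_of_act sy.
  exists b, a, a', w; split=> //.
  by rewrite -(emap_proj (rho_arrow a)) /= wy.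
- move=> c d a a' y yx aa'.
  have := arrow_funP a y; have := arrow_funP a' y.
  rewrite [arrow_fun a y]aa' => a'y ay.
  (* [s'^-1 s] fixes [y], hence lies above an idempotent [e] acting on [y], and
     [s] and [s'] agree on the domain of [e c]. *)
  have [e [ee es ey]] := act_fix (actM ay (act_sinv a'y)).
  have cc : Idem S (\val (c : Idem S)) := set_mem (valP (c : Idem S)).
  pose b : Idem S := SigSub (mem_set (idem_mul ee cc)).
  have [w wy] := @idem_domain_in b (\val y) (actM (idem_domainP y) ey).
  have bc : nle (ran (\val b)) (\val (c : Idem S)).
    by rewrite (ran_idem (idem_mul ee cc)); exact: idem_mul_nle.
  pose g : @hom (loganathan S) b c :=
    @LogHom S b c (\val b) (dom_idem (idem_mul ee cc)) bc.
  exists b, g, w; split; first by rewrite /= wy.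
    apply: log_hom_eq; rewrite /=.
    have da := log_dom (a : log_hom c d); have da' := log_dom (a' : log_hom c d).
    set s := log_elt (a : log_hom c d) in da *.
    set s' := log_elt (a' : log_hom c d) in da' *.
    apply/esym; apply: nle_dom_eq; last first.
      by apply: etrans (esym _); apply: dom_mul; rewrite ?da ?da'.
    have le : nle (s' * e) s.
      apply: (nle_trans (t := s' * (sinv s' * s))).
        by apply: nle_mul es; exact: nle_refl.
      by rewrite mulgA; exact/idem_mul_nle/idem_ran.
    have le2 := nle_mul le (nle_refl (e * \val (c : Idem S))).
    by move: le2; rewrite mulgA -(mulgA s') ee -mulgA.
  apply: arrow_funE; rewrite /= wy; apply: actM ey; exact: idem_domainP.
Qed.

End RhoObject.

Section RhoMap.
Variables (E E' : univ_sset S X) (m : univ_map E E').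

Lemma restrict_defined (e : loganathan S) (y : idem_domain E e) :
  exists z : idem_domain E' e, \val z = m (\val y).
Proof. exact/idem_domain_in/umap_act/idem_domainP. Qed.

Definition restrict_fun (e : loganathan S) (y : idem_domain E e) :
  idem_domain E' e := sval (cid (restrict_defined y)).

Lemma restrict_funE (e : loganathan S) (y : idem_domain E e) :
  \val (restrict_fun y) = m (\val y).
Proof. by rewrite /restrict_fun; case: cid. Qed.

Lemma restrict_fun_cont (e : loganathan S) : continuous (@restrict_fun e).
Proof.
apply/continuousP => _ [V oV <-]; exists (m @^-1` V).
  by apply: (continuousP _).1 oV; exact: emap_cont.
by apply/funext => y; exact: (congr1 V (esym (restrict_funE y))).
Qed.

Lemma restrict_fun_proj (e : loganathan S) (y : idem_domain E e) :
  eproj (restrict_fun y) = eproj y.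
Proof. exact: etrans (congr1 _ (restrict_funE y)) (emap_proj m _). Qed.

Definition rho_component (e : loganathan S) :
    @hom (Sh X) (idem_domain E e) (idem_domain E' e) :=
  EtaleMap (@restrict_fun_cont e) (@restrict_fun_proj e).

Lemma rho_component_natural (e f : loganathan S) (a : hom e f) :
  rho_component f \c rho_arrow E a = rho_arrow E' a \c rho_component e.
Proof.
apply: etale_map_eq => y; apply/esym/arrow_funE.
by rewrite /= !restrict_funE; exact/umap_act/arrow_funP.
Qed.

Definition rho_natural : natural (rho_functor E) (rho_functor E') :=
  @Natural (loganathan S) (Sh X) (rho_functor E) (rho_functor E')
    rho_component rho_component_natural.

End RhoMap.

Definition rho_obj (E : Univ S X) : Prin S X :=
  exist _ (rho_functor (E : univ_sset S X)) (@rho_principal E).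

Definition rho_hom (E E' : Univ S X) (m : hom E E') :
    hom (rho_obj E) (rho_obj E') :=
  rho_natural (m : univ_map E E').

Lemma rho_hom1 (E : Univ S X) : rho_hom (idm E) = idm (rho_obj E).
Proof.
apply: natural_eq => e; apply: etale_map_eq => y.
by apply: val_inj; rewrite /= restrict_funE.
Qed.

Lemma rho_homM (E E' E'' : Univ S X) (n : hom E' E'') (m : hom E E') :
  rho_hom (n \c m) = rho_hom n \c rho_hom m.
Proof.
apply: natural_eq => e; apply: etale_map_eq => y.
by apply: val_inj; rewrite /= !restrict_funE.
Qed.

Definition rho : functor (Univ S X) (Prin S X) := Functor rho_hom1 rho_homM.

Section Glue.
Variables (E E' : univ_sset S X) (n : natural (rho_functor E) (rho_functor E')).

Lemma idem_domain_cover (y : E) :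
  exists (e : loganathan S) (y' : idem_domain E e), \val y' = y.
Proof.
have [s sy] := act_effective (uact E) y; have [z sz] := act_some sy.
exists (SigSub (mem_set (idem_dom s))).
have [y' y'y] := @idem_domain_in E (SigSub (mem_set (idem_dom s))) y (act_dom sz).
by exists y'.
Qed.

(** Naturality only speaks of arrows of [L(S)], that is, of [s] acting on the
    domain of [s^-1 s]; the span of [span_of_act] extends it to any two domains
    containing [y] and [z]. *)
Lemma natural_act s (c d : loganathan S) (y : idem_domain E c) (z : idem_domain E d) :
    act (uact E) s (\val y) = Some (\val z) ->
  act (uact E') s (\val (emap (n c) y)) = Some (\val (emap (n d) z)).
Proof.
move=> /span_of_act[b [a [a' [w [<- <- aa a's]]]]].
have nE f (k : hom b f) : emap (n f) (arrow_fun k w) = arrow_fun k (emap (n b) w).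
  exact: (congr1 (fun h : @hom (Sh X) (idem_domain E b) (idem_domain E' f) =>
    emap (h : etale_map _ _) w) (nappE n k)).
rewrite !nE (act_idem aa (arrow_funP a (emap (n b) w))).
exact: act_nle a's (arrow_funP a' _).
Qed.

Lemma natural_val (c d : loganathan S) (y : idem_domain E c) (z : idem_domain E d) :
  \val y = \val z -> \val (emap (n c) y) = \val (emap (n d) z).
Proof.
move=> yz; have yy := idem_domainP y; rewrite [X in Some X]yz in yy.
by rewrite (act_idem (set_mem (valP (c : Idem S))) (natural_act yy)).
Qed.

Lemma glue_exists (y : E) : exists z : E',
  forall (e : loganathan S) (y' : idem_domain E e),
    \val y' = y -> \val (emap (n e) y') = z.
Proof.
have [e [y' y'y]] := idem_domain_cover y; exists (\val (emap (n e) y')).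
by move=> f z zy; apply: natural_val; rewrite zy.
Qed.

Definition glue_fun (y : E) : E' := sval (cid (glue_exists y)).

Lemma glue_funE (e : loganathan S) (y : idem_domain E e) :
  glue_fun (\val y) = \val (emap (n e) y).
Proof. by rewrite /glue_fun; case: cid => z /= /(_ e y erefl). Qed.

(** Each [D_e] is open, so continuity can be tested on these subspaces. *)
Lemma glue_fun_cont : continuous glue_fun.
Proof.
apply/continuousP => V oV.
suff -> : glue_fun @^-1` V = \bigcup_(e : Idem S)
    [set \val y | y in [set y : idem_domain E e | V (\val (emap (n e) y))]].
  apply: bigcup_open => e _.
  have cV : continuous (fun y : idem_domain E e => \val (emap (n e) y) : E').
    move=> y; apply: continuous_comp; first exact: emap_cont.
    exact: initial_continuous.
  have [W oW WV] := (continuousP _).1 cV V oV.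
  have -> : [set y : idem_domain E e | V (\val (emap (n e) y))] = \val @^-1` W by [].
  suff -> : [set \val y | y in (\val @^-1` W : set (idem_domain E e))] =
     [set y | act (uact E) (\val e) y] `&` W by apply: openI => //; exact: U2.
  apply/seteqP; split=> [_ [y Wy <-]|y [ey Wy]].
    by split=> //; exact: set_mem (valP y).
  by exists (SigSub (mem_set ey)).
apply/seteqP; split=> [y Vy|_ [e _ [y Vy <-]]]; last by rewrite /= glue_funE.
have [e [y' y'y]] := idem_domain_cover y; exists e => //.
by exists y'; rewrite //= -glue_funE y'y.
Qed.

Lemma glue_fun_proj y : eproj (glue_fun y) = eproj y.
Proof.
have [e [y' <-]] := idem_domain_cover y.
by rewrite glue_funE; exact: emap_proj (n e) y'.
Qed.

Lemma glue_fun_act s y z : act (uact E) s y = Some z ->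
  act (uact E') s (glue_fun y) = Some (glue_fun z).
Proof.
have [c [y' <-]] := idem_domain_cover y; have [d [z' <-]] := idem_domain_cover z.
by rewrite !glue_funE; exact: natural_act.
Qed.

Definition glue : univ_map E E' :=
  @UnivMap _ _ E E' (EtaleMap glue_fun_cont glue_fun_proj) glue_fun_act.

End Glue.

Lemma rho_full_faithful : full_faithful rho.
Proof.
move=> E E' n; exists (glue n : hom E E'); split.
  apply: natural_eq => e; apply: etale_map_eq => y; apply: val_inj.
  by rewrite /= restrict_funE /= glue_funE.
move=> m <-; apply: univ_map_eq; apply: etale_map_eq => y.
have [e [y' <-]] := idem_domain_cover y.
by rewrite /= glue_funE /= restrict_funE.
Qed.

End Rho.

(** * The universal S-set of a principal bundle *)

Section TotalSpace.
Variables (S : inverseSemigroupType) (X : topologicalType).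
Variable P : functor (loganathan S) (Sh X).
Hypothesis P_principal : principal P.
Implicit Types (s t : S) (b c d e : loganathan S).

Local Notation elt a := (log_elt (a : log_hom _ _)).

Lemma bundle_act_cmp b c d (a' : hom c d) (a : hom b c) (w : espace (P b)) :
  bundle_act (a' \c a) w = bundle_act a' (bundle_act a w).
Proof. by rewrite /bundle_act fhomM. Qed.

Lemma bundle_act_proj c d (a : hom c d) (y : espace (P c)) :
  eproj (bundle_act a y) = eproj y.
Proof. exact: emap_proj. Qed.

Definition point : choiceType := {c : Idem S & espace (P c)}.

Definition pt c (y : espace (P c)) : point := existT _ (c : Idem S) y.

(** The relation [q = s . p], expressed without knowing that [p] lies in the
    domain of [s]: both points come from one point [w] over a smaller
    idempotent. As [a'] has the same domain as [a], the product [s * elt a] is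
    automatically a composable one. *)
Definition point_rel s (p q : point) : Prop :=
  exists b (a : hom b (tag p : loganathan S)) (a' : hom b (tag q : loganathan S))
      (w : espace (P b)),
    [/\ elt a' = s * elt a, bundle_act a w = tagged p & bundle_act a' w = tagged q].

Lemma dom_elt b c d (a : hom b c) (a' : hom b d) : dom (elt a) = dom (elt a').
Proof. by rewrite (log_dom (a : log_hom b c)) (log_dom (a' : log_hom b d)). Qed.

Lemma elt_fix s b c d (a : hom b c) (a' : hom b d) :
  elt a' = s * elt a -> dom s * elt a = elt a.
Proof. by move=> a'E; apply: dom_mul_fix; rewrite -a'E; exact: dom_elt. Qed.

Lemma point_rel_proj s p q : point_rel s p q ->
  eproj (tagged p : espace (P (tag p))) = eproj (tagged q : espace (P (tag q))).
Proof. by move=> [b [a [a' [w [_ <- <-]]]]]; rewrite !bundle_act_proj. Qed.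

Lemma point_rel_arrow c d (a : hom c d) (y : espace (P c)) :
  point_rel (elt a) (pt y) (pt (bundle_act a y)).
Proof.
exists c, (idm c), a, y; split=> //.
  by rewrite /= -(log_dom (a : log_hom c d)) mulg_dom.
by rewrite /bundle_act fhom1.
Qed.

Lemma point_rel_refl p : point_rel (\val (tag p)) p p.
Proof.
case: p => c y; have := point_rel_arrow (idm (c : loganathan S)) y.
by rewrite /bundle_act fhom1.
Qed.

Lemma point_relV s p q : point_rel s p q -> point_rel (sinv s) q p.
Proof.
move=> [b [a [a' [w [a'E aw a'w]]]]]; exists b, a', a, w; split=> //.
by rewrite a'E mulgA -/(dom s) (elt_fix a'E).
Qed.

Lemma point_rel_nle s t p q : nle s t -> point_rel s p q -> point_rel t p q.
Proof.
move=> st [b [a [a' [w [a'E aw a'w]]]]]; exists b, a, a', w; split=> //.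
by rewrite a'E {1}(nle_mul_dom st) -mulgA (elt_fix a'E).
Qed.

(** The two witnesses [w] and [v] have a common refinement by (PB2); it yields
    two arrows to the middle point [q], which (PB3) makes equal after one more
    refinement. *)
Lemma point_relM s t p q r :
  point_rel s p q -> point_rel t q r -> point_rel (t * s) p r.
Proof.
move=> [b [a [a' [w [a'E aw a'w]]]]] [b' [d [d' [v [d'E dv d'v]]]]].
have [_ pb2 pb3] := P_principal (eproj w).
have vw : eproj v = eproj w.
  by rewrite -(bundle_act_proj d) dv -a'w bundle_act_proj.
have [b2 [k [l [u [uw ku lu]]]]] := pb2 _ _ w v erefl vw.
have [|b3 [g [z [_ gE gz]]]] := pb3 _ _ (a' \c k) (d \c l) u uw.
  by rewrite !bundle_act_cmp ku lu a'w dv.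
exists b3, (a \c k \c g), (d' \c l \c g), z; split.
- have E : elt a' * elt k * elt g = elt d * elt l * elt g :=
    congr1 (fun h => elt h) gE.
  by rewrite /= d'E -!mulgA (mulgA (elt d)) -E a'E !mulgA.
- by rewrite !bundle_act_cmp gz ku.
- by rewrite !bundle_act_cmp gz lu.
Qed.

(** The intermediate point is the image of [w] over the range of [s * elt a]. *)
Lemma point_relM_inv s t p r : point_rel (t * s) p r ->
  exists2 q, point_rel s p q & point_rel t q r.
Proof.
move=> [b [a [a' [w [a'E aw a'w]]]]].
have db : dom (s * elt a) = \val (b : Idem S).
  have fa := elt_fix a'E.
  have le : nle (dom (t * s)) (dom s) := dom_mul_nle t s.
  rewrite -(log_dom (a : log_hom _ _)); apply: dom_mul.
  have : nle (ran (dom (t * s) * elt a)) (ran (dom (t * s))) := ran_mul_nle _ _.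
  rewrite fa (ran_idem (idem_dom _)).
  by move=> le'; exact: nle_trans le' le.
pose c : Idem S := SigSub (mem_set (idem_ran (s * elt a))).
pose h : @hom (loganathan S) b c := @LogHom S b c (s * elt a) db (nle_refl _).
exists (pt (bundle_act h w)); first by exists b, a, h, w.
by exists b, h, a', w; split=> //; rewrite a'E mulgA.
Qed.

Definition same_point p q : bool := `[< exists2 e, Idem S e & point_rel e p q >].

Lemma same_point_equiv : equiv_class_of same_point.
Proof.
split.
- move=> p; apply/asboolP; exists (\val (tag p)); last exact: point_rel_refl.
  exact: set_mem (valP (tag p)).
- suff sym p q : same_point p q -> same_point q p.
    by move=> p q; apply/idP/idP => /sym.
  move=> /asboolP[e ee pq]; apply/asboolP; exists e => //.
  by rewrite -(idem_sinv ee); exact: point_relV.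
- move=> q p r /asboolP[e ee pq] /asboolP[f ff qr]; apply/asboolP.
  by exists (f * e); [exact: idem_mul | exact: point_relM pq qr].
Qed.

Canonical same_point_rel := EquivRelPack same_point_equiv.

Definition total := {eq_quot same_point_rel}.

HB.instance Definition _ := Choice.on total.

Definition cls (p : point) : total := \pi_({eq_quot same_point_rel})%qT p.

Lemma cls_eqP p q : cls p = cls q <-> exists2 e, Idem S e & point_rel e p q.
Proof. split=> [/eqmodP/asboolP //|pq]; exact/eqmodP/asboolP. Qed.

Lemma cls_surj (x : total) : exists p, cls p = x.
Proof. by exists (repr x); exact: reprK. Qed.

Definition chart c (y : espace (P c)) : total := cls (pt y).

Lemma chart_surj (x : total) : exists c (y : espace (P c)), chart y = x.
Proof. by have [[c y] <-] := cls_surj x; exists c, y. Qed.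

(** The final topology for the charts. That their images are open, so that the
    quotient is glued along open subspaces, is [chart_open]. *)
Definition total_open : set (set total) :=
  [set U | forall c, open (@chart c @^-1` U)].

Lemma total_openT : total_open setT.
Proof. by move=> c; exact: openT. Qed.

Lemma total_openI A B : total_open A -> total_open B -> total_open (A `&` B).
Proof. by move=> oA oB c; exact: openI (oA c) (oB c). Qed.

Lemma total_open_bigU I (f : I -> set total) :
  (forall i, total_open (f i)) -> total_open (\bigcup_i f i).
Proof. by move=> of_ c; apply: bigcup_open => i _; exact: of_. Qed.

HB.instance Definition _ :=
  isOpenTopological.Build total total_openT total_openI total_open_bigU.

Lemma total_openE (U : set total) :
  open U = forall c, open (@chart c @^-1` U).
Proof. by []. Qed.

(** Related by an idempotent [e], two points are images of [w] under arrows [a]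
    and [e a = a], so they coincide once they lie in the same sheaf. *)
Lemma chart_inj c : injective (@chart c).
Proof.
move=> y z /cls_eqP[e ee [b [a [a' [w [a'E]]]]]] /= <- <-.
congr (bundle_act _ w); apply: log_hom_eq.
by rewrite a'E -(elt_fix a'E) (dom_idem ee) mulgA ee.
Qed.

(** The set is the union, over all pairs of arrows [a] and [a'] witnessing the
    relation, of [a . (a'^-1 W)], and étale maps are open. *)
Lemma point_rel_open s c d (W : set (espace (P d))) : open W ->
  open [set y : espace (P c) | exists2 z, W z & point_rel s (pt y) (pt z)].
Proof.
move=> oW.
pose span := {b : Idem S & (log_hom b c * log_hom b d)%type}.
have -> : [set y : espace (P c) | exists2 z, W z & point_rel s (pt y) (pt z)] =
    \bigcup_(i in [set i : span | log_elt (tagged i).2 = s * log_elt (tagged i).1])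
      (bundle_act ((tagged i).1 : @hom (loganathan S) (tag i) c) @`
        (bundle_act (E := P) ((tagged i).2 : @hom (loganathan S) (tag i) d) @^-1` W)).
  apply/seteqP; split=> [y [z Wz [b [a [a' [w [a'E aw a'w]]]]]]|].
    exists (existT _ b (a, a')) => //; exists w => //=.
    by rewrite /preimage /= a'w.
  move=> y [[b [a a']] /= a'E [w Ww <-]].
  by exists (bundle_act (a' : @hom (loganathan S) b d) w) => //; exists b, a, a', w.
apply: bigcup_open => i _; apply: etale_map_open.
by apply: (continuousP _).1 oW; exact: emap_cont.
Qed.

Lemma chart_open c : open_map (@chart c).
Proof.
move=> V oV; rewrite total_openE => d.
have -> : @chart d @^-1` (@chart c @` V) = \bigcup_(e in Idem S)
    [set y | exists2 z, V z & point_rel e (pt y) (pt z)].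
  apply/seteqP; split=> [y [z Vz /esym/cls_eqP[e ee yz]]|y [e ee [z Vz yz]]].
    by exists e => //; exists z.
  by exists z => //; apply/esym/cls_eqP; exists e.
by apply: bigcup_open => e _; exact: point_rel_open.
Qed.

Definition total_proj (x : total) : X :=
  eproj (tagged (repr x : point) : espace (P (tag (repr x : point)))).

Lemma total_projE c (y : espace (P c)) : total_proj (chart y) = eproj y.
Proof.
have /cls_eqP[e _ /point_rel_proj] : cls (repr (chart y)) = cls (pt y) := reprK _.
by [].
Qed.

Lemma total_local : local_homeomorphism total_proj.
Proof.
apply/local_homeomorphismP; split.
- apply/continuousP => U oU; rewrite total_openE => c.
  have -> : @chart c @^-1` (total_proj @^-1` U) = eproj (e := P c) @^-1` U.
    by apply/funext => y; rewrite /preimage /= total_projE.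
  have [cp _ _] := (local_homeomorphismP _).1 (eproj_local (e := P c)).
  exact: (continuousP _).1 cp U oU.
- move=> V; rewrite total_openE => oV.
  have -> : total_proj @` V =
      \bigcup_(c : Idem S) (eproj (e := P c) @` (@chart c @^-1` V)).
    apply/seteqP; split=> [_ [x Vx <-]|_ [c _ [y Vy <-]]].
      have [c [y yx]] := chart_surj x; exists c => //.
      by exists y; rewrite /preimage /= ?yx // -yx total_projE.
    by exists (chart y) => //; exact: total_projE.
  apply: bigcup_open => c _.
  have [_ op _] := (local_homeomorphismP _).1 (eproj_local (e := P c)).
  exact: op (oV c).
- move=> x; have [c [y <-]] := chart_surj x.
  have [_ _ ip] := (local_homeomorphismP _).1 (eproj_local (e := P c)).
  have [U [oU Uy injU]] := ip y.
  exists (@chart c @` U); split; [exact: chart_open | by exists y |].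
  move=> _ _ /set_mem[u Uu <-] /set_mem[v Uv <-]; rewrite !total_projE => uv.
  by congr chart; apply: injU; rewrite ?inE.
Qed.

Definition total_etale : etale X := Etale total_local.

Definition total_rel s (x y : total) : Prop := point_rel s (repr x) (repr y).

Lemma total_relP s p q : total_rel s (cls p) (cls q) <-> point_rel s p q.
Proof.
have sub p' q' p1 q1 : cls p1 = cls p' -> cls q1 = cls q' ->
    point_rel s p1 q1 -> point_rel s p' q'.
  move=> /esym/cls_eqP[e ee pp] /cls_eqP[f ff qq] pq.
  apply: point_rel_nle (point_relM (point_relM pp pq) qq).
  rewrite mulgA; apply: (nle_trans (t := f * s)); last exact: idem_mul_nle.
  by exists e.
by split; apply: sub; rewrite /cls reprK.
Qed.

Lemma total_rel_fun s x y z : total_rel s x y -> total_rel s x z -> y = z.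
Proof.
have [p <-] := cls_surj x; have [q <-] := cls_surj y; have [r <-] := cls_surj z.
move=> /total_relP pq /total_relP pr; apply/cls_eqP; exists (ran s).
  exact: idem_ran.
exact: point_relM (point_relV pq) pr.
Qed.

Lemma total_relV s x y : total_rel s x y -> total_rel (sinv s) y x.
Proof. exact: point_relV. Qed.

Definition total_fun s (x : total) : option total :=
  if pselect (exists y, total_rel s x y) is left h then Some (sval (cid h))
  else None.

Lemma total_funP s x y : total_fun s x = Some y <-> total_rel s x y.
Proof.
rewrite /total_fun; case: pselect => [h|nh]; last by split=> // xy; case: nh; exists y.
by case: cid => z /= xz; split=> [[<-]|/(total_rel_fun xz) ->].
Qed.

Lemma total_fun_inj s x x' y :
  total_fun s x = Some y -> total_fun s x' = Some y -> x = x'.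
Proof.
by move=> /total_funP/total_relV xy /total_funP/total_relV/(total_rel_fun xy).
Qed.

Definition total_pbij s : pbij total := PBij (@total_fun_inj s).

Lemma total_pbijM : {morph total_pbij : s t / s * t}.
Proof.
move=> s t; apply: pbij_eq => x /=; rewrite /pcomp /=.
have E z : total_fun (s * t) x = Some z <->
    obind (total_fun s) (total_fun t x) = Some z.
  split=> [/total_funP/point_relM_inv[q xq qz]|].
    have xq' : total_rel t x (cls q) by rewrite -[x]reprK; exact/total_relP.
    have qz' : total_rel s (cls q) z by rewrite -[z]reprK; exact/total_relP.
    by rewrite ((total_funP _ _ _).2 xq') /=; exact/total_funP.
  case tx : (total_fun t x) => [y|] //= /total_funP yz; apply/total_funP.
  by apply: point_relM yz; exact/total_funP.
case sx : (total_fun (s * t) x) => [z|]; first by apply/esym/E.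
by case ox : (obind _ _) => [z|] //; move/E: ox; rewrite sx.
Qed.

HB.instance Definition _ :=
  isMultiplicative.Build S (pbij total) total_pbij total_pbijM.

Lemma total_fun_chart s c d (y : espace (P c)) (z : espace (P d)) :
  total_fun s (chart y) = Some (chart z) <-> point_rel s (pt y) (pt z).
Proof. by split=> [/total_funP/total_relP|/total_relP/total_funP]. Qed.

Lemma total_effective x : exists s, total_pbij s x.
Proof.
have [c [y <-]] := chart_surj x; exists (\val (c : Idem S)).
suff /= -> : total_fun (\val (c : Idem S)) (chart y) = Some (chart y) by [].
by apply/total_fun_chart; exact: point_rel_refl.
Qed.

Definition total_action : action S total_etale :=
  Action (act := total_pbij : {multiplicative S -> pbij total}) total_effective.

Lemma total_stalk_nonempty x :
  exists2 y, @stalk X total_etale x y & exists s, act total_action s y.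
Proof.
have [[c [y yx]] _ _] := P_principal x; exists (chart y); last exact: total_effective.
by rewrite /stalk /= total_projE.
Qed.

Lemma total_preimage_open s (V : set total) : open V ->
  open [set x | exists2 y, act total_action s x = Some y & V y].
Proof.
rewrite total_openE => oV; rewrite total_openE => c.
have -> : @chart c @^-1` [set x | exists2 y, act total_action s x = Some y & V y] =
    \bigcup_(d : Idem S)
      [set y | exists2 z, (@chart d @^-1` V) z & point_rel s (pt y) (pt z)].
  apply/seteqP; split=> [y [x sy Vx]|y [d _ [z Vz yz]]].
    have [d [z zx]] := chart_surj x; exists d => //.
    exists z; rewrite /preimage /= ?zx //.
    by apply/total_fun_chart; rewrite zx.
  by exists (chart z) => //; exact/total_fun_chart.
by apply: bigcup_open => d _; apply: point_rel_open; exact: oV.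
Qed.

Lemma total_domain_open s : open [set x | act total_action s x].
Proof.
have := total_preimage_open s openT.
congr open; apply/seteqP; split=> x; first by move=> [y /= ->].
by move=> sx; have [y xy] := act_some sx; exists y.
Qed.

Lemma total_act_over : act_over total_action.
Proof.
move=> s x y; have [c [u <-]] := chart_surj x; have [d [v <-]] := chart_surj y.
move=> /total_fun_chart/point_rel_proj uv; rewrite /= !total_projE.
exact: esym uv.
Qed.

(** Transitivity is (PB2), the span [a], [a'] giving the element [a' a^-1]. For
    the stabilizers, a witness of [s . y = y] consists of two arrows [a] and
    [a' = s a] with [a . w = a' . w]; the arrow [g] given by (PB3) satisfies
    [a g = s a g], so the idempotent [ran (a g)] lies below [s]. *)
Lemma total_stalk_universal x : universal (stalk_sset total_act_over x).
Proof.
have [_ pb2 pb3] := P_principal x; apply/universalP; split.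
- have [y yx _] := total_stalk_nonempty x.
  exact: inhabits (SigSub (mem_set (yx : @stalk X total_etale x y))).
- move=> [y0 yx] [z0 zx].
  have [c [y yE]] := chart_surj y0; have [d [z zE]] := chart_surj z0.
  have yx' : eproj y = x by rewrite -total_projE yE; exact: set_mem yx.
  have zx' : eproj z = x by rewrite -total_projE zE; exact: set_mem zx.
  have [b [a [a' [w [wx aw a'w]]]]] := pb2 _ _ y z yx' zx'.
  exists (elt a' * sinv (elt a)); apply/stalk_actP; rewrite /= -yE -zE.
  apply/total_fun_chart; exists b, a, a', w; split=> //.
  by rewrite -mulgA -/(dom _) (dom_elt a a') mulg_dom.
- move=> s [y0 yx] /stalk_actP sy; have [c [y yE]] := chart_surj y0.
  have yx' : eproj y = x by rewrite -total_projE yE; exact: set_mem yx.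
  move: sy; rewrite [\val _]/= -[in X in X -> _]yE.
  move=> /total_fun_chart[b [a [a' [w [a'E aw a'w]]]]]; rewrite /= in aw a'w.
  have wx : eproj w = x by rewrite -(bundle_act_proj a) aw.
  have [|b2 [g [v [vx gE gv]]]] := pb3 _ _ a a' w wx; first by rewrite aw a'w.
  have E : elt a * elt g = s * (elt a * elt g).
    rewrite mulgA -a'E.
    exact: (congr1 (fun h : @hom (loganathan S) b2 c => elt h) gE).
  exists (ran (elt a * elt g)); split; first exact: idem_ran.
    by exists (ran (elt a * elt g)); [exact: idem_ran | rewrite /ran mulgA -E].
  apply/stalk_actP; rewrite /= -yE; apply/total_fun_chart.
  exists b2, (a \c g), (a \c g), v; split; rewrite ?bundle_act_cmp ?gv //.
  by rewrite ran_mulg.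
Qed.

Lemma total_act_cont :
  {within [set p : discrete_topology S * total_etale | act total_action p.1 p.2],
    continuous (fun p => odflt p.2 (act total_action p.1 p.2))}.
Proof.
by apply/act_continuousP; [exact: total_domain_open | exact: total_preimage_open].
Qed.

Definition total_univ : univ_sset S X :=
  UnivSSet total_stalk_nonempty total_domain_open total_stalk_universal
    total_act_cont.

Lemma chart_defined e (y : espace (P e)) :
  exists z : idem_domain total_univ e, \val z = chart y.
Proof. by apply: idem_domain_in; apply/total_fun_chart; exact: point_rel_refl. Qed.

Definition chart_fun e (y : espace (P e)) : idem_domain total_univ e :=
  sval (cid (chart_defined y)).

Lemma chart_funE e (y : espace (P e)) : \val (chart_fun y) = chart y.
Proof. by rewrite /chart_fun; case: cid. Qed.

Lemma chart_fun_cont e : continuous (@chart_fun e).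
Proof.
apply/continuousP => _ [V oV <-].
have -> : @chart_fun e @^-1` (\val @^-1` V) = @chart e @^-1` V.
  by apply/funext => y; exact: (congr1 V (chart_funE y)).
exact: oV.
Qed.

Lemma chart_fun_proj e (y : espace (P e)) : eproj (chart_fun y) = eproj y.
Proof. exact: etrans (congr1 _ (chart_funE y)) (total_projE y). Qed.

Definition chart_map e : @hom (Sh X) (P e) (idem_domain total_univ e) :=
  EtaleMap (@chart_fun_cont e) (@chart_fun_proj e).

Lemma chart_map_natural c d (a : hom c d) :
  chart_map d \c fhom P a = rho_arrow total_univ a \c chart_map c.
Proof.
apply: etale_map_eq => y; apply/esym/arrow_funE; rewrite /= !chart_funE.
by apply/total_fun_chart; exact: point_rel_arrow.
Qed.

(** If [e] acts on the class of [y], a witness [a] satisfies [e a = a], so it is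
    also an arrow into [e] and moves the representative into [P e]. *)
Lemma chart_fun_surj e (x : idem_domain total_univ e) : exists y, chart_fun y = x.
Proof.
have := idem_domainP x; have [c [y yx]] := chart_surj (\val x).
rewrite -yx => /total_fun_chart[b [a [a' [w [a'E aw a'w]]]]]; rewrite /= in aw a'w.
have ee : Idem S (\val (e : Idem S)) := set_mem (valP (e : Idem S)).
have ea : \val (e : Idem S) * elt a = elt a.
  by have := elt_fix a'E; rewrite dom_idem.
have ae : nle (ran (elt a)) (\val (e : Idem S)).
  rewrite -ea -[X in nle _ X](ran_idem ee); exact: ran_mul_nle.
pose h : @hom (loganathan S) b e :=
  @LogHom S b e (elt a) (log_dom (a : log_hom _ _)) ae.
exists (bundle_act h w); apply: val_inj; rewrite chart_funE -yx.
apply/esym/cls_eqP; exists (\val (e : Idem S)) => //.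
by exists b, a, h, w; split.
Qed.

Lemma chart_fun_bij e : bijective (@chart_fun e).
Proof.
have /choice[g gK] := @chart_fun_surj e; exists g => // y.
by apply: (@chart_inj e); rewrite -!chart_funE gK.
Qed.

Definition chart_natural : natural P (rho_functor total_univ) :=
  @Natural (loganathan S) (Sh X) P (rho_functor total_univ) chart_map chart_map_natural.

End TotalSpace.

Lemma rho_essentially_surjective (S : inverseSemigroupType) (X : topologicalType) :
  essentially_surjective (@rho S X).
Proof.
move=> [P P_principal]; exists (total_univ P_principal).
have [u [v [vu uv]]] : @isomorphic (functor_category (loganathan S) (Sh X))
    P (rho_functor (total_univ P_principal)).
  apply: (natural_isomorphic (u := chart_natural P_principal)) => e.
  have [g [gf fg]] := @etale_bijective_iso X _ _ (chart_map P_principal e)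
    (chart_fun_bij P_principal e).
  by exists g; split; [exact: gf | exact: fg].
by exists v, u.
Qed.

Theorem theorem17 (S : inverseSemigroupType) (X : topologicalType) :
  exists (tau : functor (Prin S X) (Univ S X))
         (rho : functor (Univ S X) (Prin S X)),
    equivalence_pair tau rho.
Proof.
have [tau tau_rho] := full_faithful_equivalence (@rho_full_faithful S X)
  (@rho_essentially_surjective S X).
by exists tau, (@rho S X).
Qed.
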